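(* Let $X$ be a complex Banach space and let $T\in B(X)$. The following are equivalent: (1) $T$ is well-bounded; (2) $T$ is an $AC(\sigma)$ operator for some nonempty compact $\sigma\subset\mathbb{R}$; (3) $\sigma(T)\subset\mathbb{R}$ and $T$ is an $AC(\sigma(T))$ operator.
   Context: Let $\sigma\subset\mathbb{C}\cong\mathbb{R}^2$ be nonempty and compact. Let $\Gamma=C([0,1],\mathbb{C})$ be the set of curves. For $\gamma\in\Gamma$ and $f:\sigma\to\mathbb{C}$ put $\operatorname{cvar}(f,\gamma)=\sup\sum_{i=1}^{n-1}|f(s_{i+1})-f(s_i)|$, the supremum over finite sequences $s_i=\gamma(t_i)\in\sigma$ with $0\le t_1\le\dots\le t_n\le 1$. For a line $l$, $\operatorname{vf}(\gamma,l)$ is the number of times $\gamma$ crosses $l$, i.e. the number of entry points: $t\in[0,1]$ with $\gamma(t)\in l$ and either $t=0$ or for every $\epsilon>0$ there is $s\in(t-\epsilon,t)\cap[0,1]$ with $\gamma(s)\notin l$. Put $\operatorname{vf}(\gamma)=\sup_l\operatorname{vf}(\gamma,l)$, $\rho(\gamma)=1/\operatorname{vf}(\gamma)$ (with $\rho(\gamma)=0$ if $\operatorname{vf}(\gamma)=\infty$), $\operatorname{var}(f,\sigma)=\sup_{\gamma\in\Gamma}\rho(\gamma)\operatorname{cvar}(f,\gamma)$, and $\|f\|_{BV(\sigma)}=\|f\|_\infty+\operatorname{var}(f,\sigma)$. $BV(\sigma)$ is the Banach algebra of all $f:\sigma\to\mathbb{C}$ with $\|f\|_{BV(\sigma)}<\infty$,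 and $AC(\sigma)$ is the closed subalgebra of $BV(\sigma)$ generated by $1$, $\boldsymbol{\lambda}$ and $\overline{\boldsymbol{\lambda}}$, where $\boldsymbol{\lambda}(z)=z$, with the $BV(\sigma)$ norm. For $\sigma=[a,b]$ these are the usual spaces of functions of bounded variation and absolutely continuous functions. $T\in B(X)$ is an $AC(\sigma)$ operator if there is a bounded unital algebra homomorphism $\psi:AC(\sigma)\to B(X)$ with $\psi(\boldsymbol{\lambda})=T$. $T$ is well-bounded if it is an $AC(J)$ operator for some compact interval $J\subset\mathbb{R}$. $\sigma(T)$ denotes the spectrum of $T$. *)

(* Defs.v *)
From HB Require Import structures.
From mathcomp Require Import all_boot all_order all_algebra.
From mathcomp Require Import complex.
From mathcomp Require Import all_classical all_reals all_analysis.
Set Implicit Arguments.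
Unset Strict Implicit.
Unset Printing Implicit Defensive.
Import Order.TTheory GRing.Theory Num.Theory.
Import numFieldNormedType.Exports.
Local Open Scope classical_set_scope.
Local Open Scope ring_scope.
Local Open Scope complex_scope.

(* MathComp norms over R[i] take values in R[i]; their values are nonnegative
   reals, so taking the real part loses nothing. *)
Definition rnorm (R : realType) (V : normedZmodType R[i]) (v : V) : R :=
  complex.Re `|v|.

(* Supremum taken in [0, +oo], so that the supremum of the empty set is 0. *)
Definition nnsup (R : realType) (A : set (\bar R)) : \bar R :=
  ereal_sup (0%E |` A).

Section Variation.
Variable R : realType.
Implicit Types (gamma : R -> R[i]^o) (sigma l : set R[i]^o).

(* A curve is represented by a function on all of R of which only the values
   on [0, 1] matter; every notion below looks at gamma on [0, 1] only. *)
Definition is_curve gamma := {within `[0, 1], continuous gamma}.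

Definition is_line l :=
  exists p v : R[i], v != 0 /\ l = [set p + t%:C * v | t in [set: R]].

Definition is_entry_point gamma l (t : R) :=
  [/\ t \in `[0, 1], l (gamma t) &
      t = 0 \/ forall e : R, 0 < e ->
        exists s : R, [/\ s \in `]t - e, t[, s \in `[0, 1] & ~ l (gamma s)]].

Definition vf_line gamma l : \bar R :=
  counting [set t | is_entry_point gamma l t].

Definition vf gamma : \bar R := ereal_sup [set vf_line gamma l | l in is_line].

(* (+oo)^-1 = 0 in \bar R; and vf gamma >= 1, as seen from any line through
   gamma 0, so that the inverse of 0 does not occur. *)
Definition rho gamma : \bar R := ((vf gamma)^-1)%E.

(* The finite sequence in sigma is s 0, ..., s n. *)
Definition cvar sigma (f : sigma -> R[i]) gamma : \bar R :=
  nnsup [set v | exists (n : nat) (t : nat -> R) (s : nat -> sigma),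
    [/\ forall i, (i <= n)%N -> t i \in `[0, 1],
        forall i, (i < n)%N -> t i <= t i.+1,
        forall i, (i <= n)%N -> \val (s i) = gamma (t i) &
        v = (\sum_(i < n) rnorm (f (s i.+1) - f (s i)))%:E]].

(* The convention 0 * +oo = 0 of \bar R applies in the product. *)
Definition var sigma (f : sigma -> R[i]) : \bar R :=
  nnsup [set (rho gamma * cvar f gamma)%E | gamma in is_curve].

Definition supnorm sigma (f : sigma -> R[i]) : \bar R :=
  nnsup (range (fun z => (rnorm (f z))%:E)).

Definition BVnorm sigma (f : sigma -> R[i]) : \bar R := (supnorm f + var f)%E.

Definition BV_space sigma : set (sigma -> R[i]) := [set f | (BVnorm f < +oo)%E].

Definition closed_subalgebra sigma (A : set (sigma -> R[i])) :=
  [/\ A `<=` @BV_space sigma,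
      forall f g, A f -> A g -> A (f \+ g),
      forall a f, A f -> A (a \*o f),
      forall f g, A f -> A g -> A (f \* g) &
      forall f : sigma -> R[i], BV_space f ->
        (forall e : R, 0 < e ->
          exists2 g, A g & (BVnorm (f \- g)%R < e%:E)%E) ->
        A f].

Definition lambda sigma : sigma -> R[i] := fun z => \val z.
Definition lambdabar sigma : sigma -> R[i] := fun z => (\val z)^*.

Definition AC_space sigma : set (sigma -> R[i]) :=
  smallest (@closed_subalgebra sigma)
    [set f | [\/ f = cst 1, f = @lambda sigma | f = @lambdabar sigma]].

End Variation.

Section Operators.
Variables (R : realType) (X : completeNormedModType R[i]).
Implicit Types (T : {linear X -> X}) (sigma : set R[i]^o).

Definition opnorm (T : X -> X) : \bar R :=
  nnsup [set (rnorm (T x))%:E | x in [set x : X | rnorm x <= 1]].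

(* psi takes values in B(X), the continuous linear operators; its values
   outside AC_space sigma are irrelevant. *)
Definition bounded_unital_homomorphism sigma
    (psi : (sigma -> R[i]) -> {linear X -> X}) :=
  [/\ forall f : sigma -> R[i], AC_space f -> continuous (psi f),
      forall f g : sigma -> R[i], AC_space f -> AC_space g ->
        psi (f \+ g) =1 psi f \+ psi g,
      forall a (f : sigma -> R[i]), AC_space f ->
        psi (a \*o f) =1 a \*: psi f,
      forall f g : sigma -> R[i], AC_space f -> AC_space g ->
        psi (f \* g) =1 psi f \o psi g &
      psi (cst 1) =1 id] /\
  (exists K : R, forall f : sigma -> R[i], AC_space f ->
    (opnorm (psi f) <= K%:E * BVnorm f)%E).

Definition AC_operator sigma T :=
  exists psi : (sigma -> R[i]) -> {linear X -> X},
    bounded_unital_homomorphism psi /\ psi (@lambda R sigma) =1 T.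

Definition well_bounded T :=
  exists a b : R, a <= b /\ AC_operator [set x%:C | x in `[a, b]] T.

Definition spectrum T : set R[i]^o :=
  [set z | ~ exists S : {linear X -> X},
    [/\ continuous S, forall x, S (z *: x - T x) = x &
        forall x, z *: S x - T (S x) = x]].

End Operators.

(* Main.v *)
Require Import Defs.
From HB Require Import structures.
From mathcomp Require Import all_boot all_order all_algebra.
From mathcomp Require Import complex.
From mathcomp Require Import all_classical all_reals all_analysis.
From mathcomp Require Import ring lra.
Set Implicit Arguments.
Unset Strict Implicit.
Unset Printing Implicit Defensive.
Import Order.TTheory GRing.Theory Num.Theory.
Import numFieldNormedType.Exports.
Local Open Scope classical_set_scope.
Local Open Scope ring_scope.
Local Open Scope complex_scope.

(** For a set [S] of reals the BV norm of the statement is the sup norm plus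
the classical total variation ([BVnorm_le]): a curve crosses the vertical line
at a level at least as often as the points sampled along it jump over that
level, and a segment run through once has weight 1. Restriction to a subset does
not increase this norm, so an AC calculus on a bounded real set induces one on
every segment containing it. This gives well-boundedness from a calculus on any
compact real set, and from one on the spectrum as soon as the spectrum is
bounded ([spectrum_bounded]).

The substance is to push a calculus [Psi] from a segment [J] down to the
spectrum. First, [1 / (z - x)] is absolutely continuous on [J] for every [z]
off [J], so the spectrum lies in [J] ([spectrum_subset]). Next, [Psi] has a
support: the complement of the points around which it kills all functions of
small support. At a point [w] with a resolvent [S], a function [g] supported in
a small ball satisfies [Psi g = S^n (Psi ((w - x)^n g))], which tends to 0, so
the support lies in the spectrum ([null_resolvent]). A connectedness argument
with cutoff functions shows that [Psi] kills every function supported in an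
interval off the support ([calc_null_segment]), and every Lipschitz function
vanishing outside an open gap of the support ([calc_null_gap]).

Consequently, if a Lipschitz function [F] is replaced on a gap by its affine
interpolation, [Psi F] is unchanged, while the variation over the gap drops to
the jump between its ends. So [Psi F] is bounded by [K] times the norm of [F]
on [J] minus finitely many gaps. As more gaps are removed, the measure of the
remaining ones tends to 0, and so does their contribution to the variation of a
Lipschitz function. In the limit [Psi F] is bounded by [K] times the norm of
[F] on the support, hence on the spectrum ([controls_support]). Lipschitz
functions are dense in AC, so [Psi] extends by continuity to a calculus on the
spectrum ([calculus_restrict]).

The elements of AC that this needs, clamps and cutoffs, come from [|x - c|],
which is a limit in variation of polynomials ([ac_abs]). *)

(** * Real-valued norms *)

Section RealNorm.
Variable R : realType.

Section Zmodule.
Variable V : normedZmodType R[i].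
Implicit Types u v w : V.

Lemma normE v : `|v| = (rnorm v)%:C.
Proof. by rewrite /rnorm RRe_real// normr_real. Qed.

Lemma rnorm_ge0 v : 0 <= rnorm v.
Proof. by rewrite -ler0c -normE. Qed.

Lemma rnormD u v : rnorm (u + v) <= rnorm u + rnorm v.
Proof. by rewrite -lecR rmorphD/= -!normE ler_normD. Qed.

Lemma rnormN v : rnorm (- v) = rnorm v.
Proof. by rewrite /rnorm normrN. Qed.

Lemma rnorm0 : rnorm (0 : V) = 0.
Proof. by rewrite /rnorm normr0. Qed.

Lemma rnormB u v : rnorm (u - v) <= rnorm u + rnorm v.
Proof. by rewrite -(rnormN v) rnormD. Qed.

Lemma rdistC u v : rnorm (u - v) = rnorm (v - u).
Proof. by rewrite /rnorm distrC. Qed.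

Lemma rdist_triangle w u v : rnorm (u - v) <= rnorm (u - w) + rnorm (w - v).
Proof. by rewrite -(subrKA w) rnormD. Qed.

Lemma rnorm_eq0 v : rnorm v <= 0 -> v = 0.
Proof.
move=> v0; apply/normr0_eq0; rewrite normE.
by have -> : rnorm v = 0 by apply/eqP; rewrite eq_le v0 rnorm_ge0.
Qed.

Lemma rnorm_small v : (forall e : R, 0 < e -> rnorm v <= e) -> v = 0.
Proof. by move=> h; apply: rnorm_eq0; apply/ler_addgt0Pl => e /h; rewrite addr0. Qed.

End Zmodule.

Lemma rnormZ (V : normedModType R[i]) (a : R[i]) (v : V) :
  rnorm (a *: v) = rnorm a * rnorm v.
Proof. by apply: complexI; rewrite rmorphM/= -!normE normrZ. Qed.

Lemma rnormM (a b : R[i]) : rnorm (a * b) = rnorm a * rnorm b.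
Proof. by apply: complexI; rewrite rmorphM/= -!normE normrM. Qed.

Lemma rnormC (x : R) : rnorm x%:C = `|x|.
Proof. by rewrite /rnorm normc_def/= expr0n/= addr0 sqrtr_sqr. Qed.

Lemma rnorm1 : rnorm (1 : R[i]) = 1.
Proof. by rewrite -[1]/(1%:C) rnormC normr1. Qed.

Lemma ler_rnorm_Re (z : R[i]) : `|complex.Re z| <= rnorm z.
Proof. by rewrite -lecR -normE normc_ge_Re. Qed.

Lemma continuous_rbound (V W : normedModType R[i]) (f : {linear V -> W}) :
  continuous f -> exists2 M : R, 0 < M & forall x, rnorm (f x) <= M * rnorm x.
Proof.
move=> /linear_bounded_continuous/linear_boundedP[r [r_real rP]].
have /rP fP : r < (`|complex.Re r| + 1)%:C.
  rewrite -(RRe_real r_real) ltcR/=.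
  by rewrite (le_lt_trans (ler_norm _))// ltrDl.
exists (`|complex.Re r| + 1); first by rewrite ltr_wpDl.
by move=> x; rewrite -lecR rmorphM/= -!normE.
Qed.

Lemma rbound_continuous (V W : normedModType R[i]) (f : {linear V -> W}) M :
  (forall x, rnorm (f x) <= M * rnorm x) -> continuous f.
Proof.
move=> fM; apply/linear_bounded_continuous/linear_boundedP.
exists (`|M|%:C); split => [|r Mr x].
  by apply/complex_realP; exists `|M|.
have rR : r \is Num.real by rewrite realE (le_trans _ (ltW Mr))// ler0c.
rewrite -(RRe_real rR) !normE -rmorphM/= lecR (le_trans (fM x))//.
rewrite ler_wpM2r ?rnorm_ge0// (le_trans (ler_norm _))//.
by rewrite -lecR RRe_real// ltW.
Qed.

End RealNorm.

(** * Functions of bounded variation on a set of reals *)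

Section BoundedVariation.
Variable R : realType.
Implicit Types (S : set R) (f g : R -> R[i]) (w h : R -> R) (M v c : R).

(** A dominating function [w], automatically nondecreasing on [S], encodes that
the total variation of [f] on [S] is at most [v]. Sums, products, compositions
and gluings are then dominated by the corresponding combinations of dominating
functions, with no partition to refine. *)
Definition var_le S f v := exists w,
  (forall x, S x -> 0 <= w x <= v) /\
  (forall x y, S x -> S y -> x <= y -> rnorm (f y - f x) <= w y - w x).

(** The bounds [c] and [v] are nonnegative by definition so that a bound on the
empty set is nonnegative as well. *)
Definition bv_le S f M := exists c v,
  [/\ 0 <= c, 0 <= v, c + v <= M, forall x, S x -> rnorm (f x) <= c &
      var_le S f v].

Lemma bv_le_ge0 S f M : bv_le S f M -> 0 <= M.
Proof. by move=> [c [v [c0 v0 cvM _ _]]]; rewrite (le_trans _ cvM) ?addr_ge0. Qed.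

Lemma bv_le_trans S f M M' : M <= M' -> bv_le S f M -> bv_le S f M'.
Proof.
move=> MM' [c [v [c0 v0 cvM fc fv]]]; exists c, v; split => //.
exact: le_trans MM'.
Qed.

Lemma bv_le_comp S S' (p : R -> R) f M :
    (forall x, S' x -> S (p x)) ->
    (forall x y, S' x -> S' y -> x <= y -> p x <= p y) ->
  bv_le S f M -> bv_le S' (f \o p) M.
Proof.
move=> pS p_mono [c [v [c0 v0 cvM fc [w [wv fw]]]]].
exists c, v; split => // [x /pS/fc//|]; exists (w \o p); split => [x /pS/wv//|].
by move=> x y xS yS xy; apply: fw; [exact: pS..|exact: p_mono].
Qed.

Lemma bv_le_subset S S' f M : S' `<=` S -> bv_le S f M -> bv_le S' f M.
Proof. by move=> S'S; apply: (@bv_le_comp _ _ id). Qed.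

Lemma eq_bv_le S f g M :
  bv_le S f M -> (forall x, S x -> f x = g x) -> bv_le S g M.
Proof.
move=> + fg; move=> [c [v [c0 v0 cvM fc [w [wv fw]]]]].
exists c, v; split => // [x Sx|]; first by rewrite -fg// fc.
exists w; split => // x y Sx Sy xy; rewrite -!fg//; exact: fw.
Qed.

Lemma bv_le_cst S (a : R[i]) : bv_le S (cst a) (rnorm a).
Proof.
exists (rnorm a), 0; split; rewrite ?rnorm_ge0 ?addr0//.
exists (cst 0); split => [x _|x y _ _ _] /=; first by rewrite lexx.
by rewrite !subrr rnorm0.
Qed.

Lemma bv_leD S f g M N : bv_le S f M -> bv_le S g N -> bv_le S (f \+ g) (M + N).
Proof.
move=> [c [v [c0 v0 cvM fc [w [wv fw]]]]] [d [u [d0 u0 duM gd [z [zu gz]]]]].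
exists (c + d), (v + u); split; rewrite ?addr_ge0//; first by lra.
- by move=> x Sx; rewrite (le_trans (rnormD _ _))// lerD ?fc ?gd.
- exists (fun x => w x + z x); split => [x Sx|x y Sx Sy xy].
    by move: (wv x Sx) (zu x Sx); lra.
  rewrite /= opprD addrACA (le_trans (rnormD _ _))//.
  by rewrite opprD addrACA lerD ?fw ?gz.
Qed.

Lemma var_le_trans S f v v' : v <= v' -> var_le S f v -> var_le S f v'.
Proof.
move=> vv' [w [wv fw]]; exists w; split => // x /wv/andP[-> wx].
exact: le_trans vv'.
Qed.

Lemma var_leM S f g c d u v : 0 <= c -> 0 <= d ->
    (forall x, S x -> rnorm (f x) <= c) -> (forall x, S x -> rnorm (g x) <= d) ->
  var_le S f v -> var_le S g u -> var_le S (f \* g) (v * d + c * u).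
Proof.
move=> c0 d0 fc gd [w [wv fw]] [z [zu gz]].
exists (fun x => w x * d + c * z x); split => [x Sx|x y Sx Sy xy].
  have /andP[w0 wlev] := wv x Sx; have /andP[z0 zleu] := zu x Sx.
  by rewrite addr_ge0 ?mulr_ge0//= lerD ?ler_wpM2r ?ler_wpM2l.
have -> : (f \* g) y - (f \* g) x = (f y - f x) * g y + f x * (g y - g x).
  by rewrite /=; ring.
rewrite (le_trans (rnormD _ _))// !rnormM.
have -> : w y * d + c * z y - (w x * d + c * z x) =
    (w y - w x) * d + c * (z y - z x) by ring.
by rewrite lerD ?ler_pM ?rnorm_ge0 ?fc ?gd ?fw ?gz.
Qed.

Lemma bv_leM S f g M N : bv_le S f M -> bv_le S g N -> bv_le S (f \* g) (M * N).
Proof.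
move=> [c [v [c0 v0 cvM fc fv]]] [d [u [d0 u0 duM gd gu]]].
exists (c * d), (v * d + c * u); split; rewrite ?addr_ge0 ?mulr_ge0//.
- rewrite (@le_trans _ _ ((c + v) * (d + u)))//.
    by rewrite mulrDl !mulrDr; have := mulr_ge0 v0 u0; lra.
  by rewrite ler_pM ?addr_ge0.
- by move=> x Sx; rewrite rnormM ler_pM ?rnorm_ge0 ?fc ?gd.
- exact: var_leM.
Qed.

Lemma bv_leZ S a f M : bv_le S f M -> bv_le S (a \*o f) (rnorm a * M).
Proof. by move=> fM; have := bv_leM (bv_le_cst S a) fM. Qed.

Lemma bv_leN S f M : bv_le S f M -> bv_le S (\- f) M.
Proof.
move=> /(bv_leZ (-1)); rewrite rnormN rnorm1 mul1r => fM.
by apply: eq_bv_le fM _ => x _ /=; rewrite mulN1r.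
Qed.

Lemma bv_leB S f g M N : bv_le S f M -> bv_le S g N -> bv_le S (f \- g) (M + N).
Proof. by move=> fM /bv_leN gN; have := bv_leD fM gN. Qed.

Lemma bv_le_nondecreasing S h l u c : l <= u -> 0 <= c ->
    (forall x, S x -> `|h x| <= c) -> (forall x, S x -> l <= h x <= u) ->
    (forall x y, S x -> S y -> x <= y -> h x <= h y) ->
  bv_le S (fun x => (h x)%:C) (c + (u - l)).
Proof.
move=> lu c0 hc hlu h_mono; exists c, (u - l); split; rewrite ?subr_ge0//.
  by move=> x Sx; rewrite rnormC hc.
exists (fun x => h x - l); split => [x Sx|x y Sx Sy xy].
  by move: (hlu x Sx); lra.
by rewrite -rmorphB rnormC ger0_norm ?subr_ge0 ?h_mono//; lra.
Qed.

Lemma bv_le_nonincreasing S h l u c : l <= u -> 0 <= c ->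
    (forall x, S x -> `|h x| <= c) -> (forall x, S x -> l <= h x <= u) ->
    (forall x y, S x -> S y -> x <= y -> h y <= h x) ->
  bv_le S (fun x => (h x)%:C) (c + (u - l)).
Proof.
move=> lu c0 hc hlu h_mono; have -> : u - l = - l - - u by ring.
have /bv_leN hN : bv_le S (fun x => (- h x)%:C) (c + (- l - - u)).
  apply: (@bv_le_nondecreasing _ (fun x => - h x)); rewrite ?lerN2//.
  - by move=> x Sx; rewrite normrN hc.
  - by move=> x /hlu; rewrite !lerN2 andbC.
  - by move=> x y Sx Sy xy; rewrite lerN2 h_mono.
by apply: eq_bv_le hN _ => x _ /=; rewrite rmorphN opprK.
Qed.

Definition is_lipschitz f := exists2 L : R, 0 <= L &
  forall x y, rnorm (f x - f y) <= L * `|x - y|.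

Lemma bv_le_lipschitz S f L a b c : 0 <= L -> a <= b -> 0 <= c ->
    (forall x, S x -> a <= x <= b) -> (forall x, S x -> rnorm (f x) <= c) ->
    (forall x y, S x -> S y -> x <= y -> rnorm (f y - f x) <= L * (y - x)) ->
  bv_le S f (c + L * (b - a)).
Proof.
move=> L0 ab c0 Sab fc fL.
exists c, (L * (b - a)); split => //; first by rewrite mulr_ge0 ?subr_ge0.
exists (fun x => L * (x - a)); split => [x Sx|x y Sx Sy xy].
  have /andP[ax xb] := Sab x Sx.
  by rewrite mulr_ge0 ?subr_ge0//= ler_wpM2l// lerD2r.
by rewrite (le_trans (fL _ _ _ _ _))// -mulrBr; lra.
Qed.

End BoundedVariation.

(** * Levels crossed by a finite sequence of reals *)

Section Crossings.
Variable R : realType.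
Implicit Types (x : nat -> R) (w g : R -> R) (c : R).

Definition crosses c (p q : R) := (p < c < q) || (q < c < p).

Lemma crosses_sym c p q : crosses c p q = crosses c q p.
Proof. by rewrite /crosses orbC. Qed.

(** Between two entries of a strictly increasing sequence, the midpoints that
are crossed are those of the steps in between, over which [w] telescopes. *)
Lemma sum_levels (s : seq R) w p q : sorted <%R s -> (p <= q)%N ->
    (q < size s)%N ->
  w s`_q - w s`_p =
  \sum_(k < (size s).-1)
    (w s`_k.+1 - w s`_k) * (crosses ((s`_k + s`_k.+1) / 2) s`_p s`_q)%:R.
Proof.
move=> s_sorted pq qs.
have s_lt i j : (i < j)%N -> (j < size s)%N -> s`_i < s`_j.
  by move=> ij js; apply: (sorted_ltn_nth lt_trans) => //; rewrite inE (ltn_trans ij).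
have s_le i j : (i <= j)%N -> (j < size s)%N -> s`_i <= s`_j.
  by rewrite leq_eqVlt => /predU1P[->//|ij js]; exact/ltW/s_lt.
have crossE (k : 'I_(size s).-1) :
    crosses ((s`_k + s`_k.+1) / 2) s`_p s`_q = (p <= k < q)%N.
  have ks : (k.+1 < size s)%N by rewrite -ltn_predRL.
  have kk := s_lt k k.+1 (ltnSn k) ks.
  have spq := s_le _ _ pq qs.
  rewrite /crosses; have -> : (s`_q < (s`_k + s`_k.+1) / 2 < s`_p) = false.
    by apply/negP; lra.
  rewrite orbF; case: (leqP p k) => pk; case: (ltnP k q) => kq /=.
  - have := s_le _ _ pk (ltn_trans (ltnSn _) ks); have := s_le _ _ kq qs; lra.
  - have := s_le _ _ kq (ltn_trans (ltnSn _) ks); lra.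
  - have := s_le _ _ pk (leq_ltn_trans pq qs); lra.
  - have := s_le _ _ pk (leq_ltn_trans pq qs); lra.
rewrite (eq_bigr (fun k : 'I_(size s).-1 => if (p <= k < q)%N
    then w s`_k.+1 - w s`_k else 0)); last first.
  by move=> k _; rewrite crossE; case: ifP; rewrite ?mulr1 ?mulr0.
rewrite -big_mkcond/= -(big_mkord (fun k => p <= k < q)%N
  (fun k => w s`_k.+1 - w s`_k)).
rewrite -(telescope_sumr (fun k => w s`_k) pq).
rewrite [LHS](big_nat_widenl p 0%N)// (big_nat_widen 0%N q (size s).-1)//=.
  by rewrite -ltnS prednK// (leq_ltn_trans _ qs).
Qed.

(** Sort the values taken by [x]. The increment of [w] between two of them is the
sum of its increments over the elementary steps in between, and each
elementary step, tested at its midpoint, is jumped over at most [N] times. *)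
Lemma sum_dist_crossings x (n : nat) w (N v : R) : 0 <= N ->
    (forall i, (i <= n)%N -> 0 <= w (x i) <= v) ->
    (forall i j, (i <= n)%N -> (j <= n)%N -> x i <= x j -> w (x i) <= w (x j)) ->
    (forall c, (forall i, (i <= n)%N -> x i != c) ->
      \sum_(i < n) (crosses c (x i) (x i.+1))%:R <= N) ->
  \sum_(i < n) `|w (x i.+1) - w (x i)| <= N * v.
Proof.
move=> N0 wv w_mono crossN.
pose s := sort <=%R (undup [seq x i | i <- iota 0 n.+1]).
have s_sorted : sorted <%R s.
  by rewrite lt_sorted_uniq_le sort_uniq undup_uniq sort_sorted//; exact: le_total.
have mem_s y : (y \in s) = (y \in [seq x i | i <- iota 0 n.+1]).
  by rewrite mem_sort mem_undup.
have xs i : (i <= n)%N -> x i \in s.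
  by move=> ni; rewrite mem_s; apply: map_f; rewrite mem_iota.
have sx k : (k < size s)%N -> exists2 i, (i <= n)%N & s`_k = x i.
  move=> ks; have := mem_nth 0 ks; rewrite mem_s => /mapP[j].
  by rewrite mem_iota add0n ltnS => /andP[_ nj] ->; exists j.
have sS k : (k < (size s).-1)%N -> (k.+1 < size s)%N by rewrite ltn_predRL.
have s_lt i j : (i < j)%N -> (j < size s)%N -> s`_i < s`_j.
  by move=> ij js; apply: (sorted_ltn_nth lt_trans) => //; rewrite inE (ltn_trans ij).
pose D k := w s`_k.+1 - w s`_k.
pose C k (i : nat) : R :=
  (crosses ((s`_k + s`_k.+1) / 2) (x i) (x i.+1))%:R.
have D0 k : (k < (size s).-1)%N -> 0 <= D k.
  move=> /sS ks; have := s_lt k k.+1 (ltnSn k) ks; rewrite /D subr_ge0.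
  have [i ni ->] := sx _ (ltn_trans (ltnSn _) ks); have [j nj ->] := sx _ ks.
  by move=> /ltW; exact: w_mono.
have step i : (i < n)%N ->
    `|w (x i.+1) - w (x i)| = \sum_(k < (size s).-1) D k * C k i.
  move=> ni; have pI := xs _ (ltnW ni); have qI := xs _ ni.
  rewrite /C -(nth_index 0 pI) -(nth_index 0 qI).
  set p := index (x i) s; set q := index (x i.+1) s.
  have ps : (p < size s)%N by rewrite index_mem.
  have qs : (q < size s)%N by rewrite index_mem.
  have [pq|/ltnW qp] := leqP p q.
    rewrite -sum_levels// ger0_norm// (sum_levels _ _ pq)// sumr_ge0// => k _.
    by rewrite mulr_ge0// D0.
  rewrite distrC (eq_bigr (fun k : 'I_(size s).-1 => D k *
    (crosses ((s`_k + s`_k.+1) / 2) s`_q s`_p)%:R)); last first.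
    by move=> k _; rewrite crosses_sym.
  rewrite -sum_levels// ger0_norm// (sum_levels _ _ qp)// sumr_ge0// => k _.
  by rewrite mulr_ge0// D0.
rewrite (eq_bigr _ (fun (i : 'I_n) _ => step i (ltn_ord i))) exchange_big/=.
under eq_bigr => k _ do rewrite -mulr_sumr.
rewrite (@le_trans _ _ (\sum_(k < (size s).-1) D k * N))//.
  apply: ler_sum => k _; rewrite ler_wpM2l ?D0// crossN// => i /xs xis.
  apply/eqP => xiE; move: (xis) xiE => /(nth_index 0) <-.
  set p := index _ _ => pE; have ps : (p < size s)%N by rewrite index_mem.
  have kk := s_lt k k.+1 (ltnSn k) (sS _ (ltn_ord k)).
  have [pk|kp] := leqP p k.
    have : s`_p <= s`_k.
      move: pk; rewrite leq_eqVlt => /predU1P[->//|pk].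
      by rewrite ltW// s_lt// (ltn_trans (ltnSn _))// sS.
    by rewrite pE; lra.
  have : s`_k.+1 <= s`_p.
    by move: kp; rewrite leq_eqVlt => /predU1P[->//|kp]; rewrite ltW// s_lt.
  by rewrite pE; lra.
rewrite -mulr_suml mulrC ler_wpM2l//.
rewrite -(big_mkord xpredT D) telescope_sumr//.
have s0 : (0 < size s)%N by case: (s) (xs 0%N (leq0n n)).
have [i ni ->] : exists2 i, (i <= n)%N & s`_(size s).-1 = x i.
  by apply: sx; rewrite prednK.
have [j nj ->] := sx _ s0.
by move: (wv _ ni) (wv _ nj); lra.
Qed.

End Crossings.

(** * Crossings of vertical lines by curves *)

Section Curves.
Variable R : realType.
Implicit Types (gamma : R -> R[i]^o) (g : R -> R) (c s t u : R).

Lemma curve_Re gamma : is_curve gamma -> forall t, t \in `[0, 1] ->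
  forall e, 0 < e -> exists2 d : R, 0 < d & forall u, u \in `[0, 1] ->
    `|u - t| < d -> `|complex.Re (gamma u) - complex.Re (gamma t)| < e.
Proof.
move=> /subspace_continuousP gamma_cont t t01 e e0.
have /cvgrPdist_lt/(_ e%:C) := gamma_cont t t01.
rewrite ltcR => /(_ e0) [/= d d0 near_t]; exists d => // u u01 ut.
rewrite distrC -raddfB (le_lt_trans (ler_rnorm_Re _))// -ltcR -normE.
by apply: near_t => //=; rewrite distrC.
Qed.

(** The hitting time is the supremum of the times up to which [g] stays below
[c]. *)
Lemma first_hit g s t c : s < t ->
    (forall t', s <= t' <= t -> forall e, 0 < e -> exists2 d : R, 0 < d &
      forall u, s <= u <= t -> `|u - t'| < d -> `|g u - g t'| < e) ->
    g s < c -> c < g t ->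
  exists r, [/\ s < r, r < t, g r = c & forall u, s <= u < r -> g u < c].
Proof.
move=> st g_cont gs gt.
pose A := [set u | s <= u <= t /\ forall u', s <= u' <= u -> g u' < c].
have As : A s.
  by split => [|u' /le_anti <-//]; rewrite lexx ltW.
have supA : has_sup A by split; [exists s | exists t => u [/andP[]]].
have sr : s <= sup A by exact: sup_upper_bound.
have rt : sup A <= t by apply: ge_sup; [exists s|move=> u [/andP[]]].
have below u : s <= u < sup A -> g u < c.
  move=> /andP[su ur]; have r_u : 0 < sup A - u by rewrite subr_gt0.
  have [a [_ gA]] := sup_adherent r_u supA.
  by rewrite opprB addrC subrK => ua; apply: gA; rewrite su ltW.
have srt : s <= sup A <= t by rewrite sr rt.
have grc : g (sup A) = c.
  apply/eqP; rewrite eq_le !leNgt; apply/andP; split; apply/negP => grc.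
    have [d d0 near_r] := g_cont _ srt (g (sup A) - c) ltac:(by rewrite subr_gt0).
    have [s_r|/eqP s_r] := eqVneq s (sup A).
      by move: grc; rewrite -s_r ltNge (ltW gs).
    pose u := Num.max s (sup A - d / 2).
    have slt : s < sup A by rewrite lt_neqAle sr andbT; apply/eqP.
    have ur : u < sup A by rewrite gt_max slt/=; lra.
    have su : s <= u by rewrite le_max lexx.
    have := below u; rewrite su ur => /(_ isT) guc.
    have : `|g u - g (sup A)| < g (sup A) - c.
      apply: near_r; first by rewrite su (le_trans (ltW ur)).
      rewrite ltr0_norm ?subr_lt0// opprB.
      have : sup A - d / 2 <= u by rewrite le_max lexx orbT.
      by lra.
    by rewrite ltr0_norm ?subr_lt0 ?(lt_trans guc)//; lra.
  have [d d0 near_r] := g_cont _ srt (c - g (sup A)) ltac:(by rewrite subr_gt0).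
  pose u := Num.min t (sup A + d / 2).
  have rlt : sup A < t.
    by rewrite lt_neqAle rt andbT; apply: contraTneq grc => ->; rewrite -leNgt ltW.
  have ru : sup A < u by rewrite lt_min rlt/=; lra.
  have ut : u <= t by rewrite ge_min lexx.
  have uc : u <= sup A + d / 2 by rewrite ge_min lexx orbT.
  have Au : A u.
    split=> [|u' /andP[su' u'u]]; first by rewrite ut (le_trans sr (ltW ru)).
    have [u'r|ru'] := ltP u' (sup A); first by rewrite below// su'.
    have : `|g u' - g (sup A)| < c - g (sup A).
      apply: near_r; first by rewrite su' (le_trans u'u).
      by rewrite ger0_norm ?subr_ge0//; lra.
    by move=> /(le_lt_trans (ler_norm _)); lra.
  by have := sup_upper_bound supA Au; rewrite leNgt ru.
exists (sup A); split => //.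
  rewrite lt_neqAle sr andbT; apply: contraTneq gs => ->.
  by rewrite grc ltxx.
rewrite lt_neqAle rt andbT; apply: contraTneq gt => <-.
by rewrite grc ltxx.
Qed.

Definition vertical c : set R[i]^o := [set z | complex.Re z = c].

Lemma is_line_vertical c : is_line (vertical c).
Proof.
exists c%:C, (0 +i* 1); split; first by rewrite eq_complex/= oner_eq0 andbF.
apply/seteqP; split => [[x y]/= xc|_ [t _ <-]]; last first.
  by rewrite /vertical/= mul0r mulr0 subr0 addr0.
exists y => //; apply/eqP; rewrite eq_complex/=; move: xc; rewrite /vertical/= => ->.
by apply/andP; split; apply/eqP; ring.
Qed.

(** The first hit of the line is an entry point: just before it the curve is
strictly on one side. *)
Lemma vertical_entry gamma c s t : is_curve gamma ->
    s \in `[0, 1] -> t \in `[0, 1] -> s <= t ->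
    crosses c (complex.Re (gamma s)) (complex.Re (gamma t)) ->
  exists2 r, s < r < t & is_entry_point gamma (vertical c) r.
Proof.
move=> gamma_curve; rewrite !in_itv/= => /andP[s0 s1] /andP[t0 t1] st cross_st.
have slt : s < t.
  by rewrite lt_neqAle st andbT; apply: contraTneq cross_st => ->; rewrite /crosses; lra.
have cont t' : s <= t' <= t -> forall e, 0 < e -> exists2 d : R, 0 < d &
    forall u, s <= u <= t -> `|u - t'| < d ->
      `|complex.Re (gamma u) - complex.Re (gamma t')| < e.
  move=> /andP[st' t't] e e0; have t'01 : t' \in `[0, 1] by rewrite in_itv/=; lra.
  have [d d0 near_t'] := curve_Re gamma_curve t'01 e0; exists d => // u sut.
  by apply: near_t'; rewrite in_itv/=; lra.
suff [r [sr rt rc before_r]] : exists r, [/\ s < r, r < t,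
    complex.Re (gamma r) = c &
    forall u, s <= u < r -> complex.Re (gamma u) <> c].
  exists r; rewrite ?sr//; split => //; first by rewrite in_itv/=; lra.
  right => e e0; exists (Num.max s (r - e / 2)); rewrite !in_itv/=.
  set u := Num.max _ _; have su : s <= u by rewrite le_max lexx.
  have eu : r - e / 2 <= u by rewrite le_max lexx orbT.
  have ur : u < r by rewrite gt_max sr/=; lra.
  split; rewrite ?ur; [lra..|]; exact/before_r/andP.
have [/andP[gs gt]|/andP[gt gs]] := orP cross_st.
  have [r [sr rt rc before_r]] := first_hit slt cont gs gt.
  by exists r; split => // u /before_r; lra.
have [|||r [sr rt rc before_r]] :=
    @first_hit (fun u => - complex.Re (gamma u)) s t (- c) slt.
- move=> t' /cont cont_t' e /cont_t'[d d0 near_t']; exists d => // u su ut.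
  by rewrite -opprD normrN near_t'.
- by rewrite ltrN2.
- by rewrite ltrN2.
exists r; split => //; first exact: oppr_inj.
by move=> u /before_r; lra.
Qed.

(** Jumps over [c] happen in disjoint open time intervals, so the entry points
that they contain are distinct. *)
Lemma crossings_le_vf gamma (n : nat) (t : nat -> R) c : is_curve gamma ->
    (forall k, (k <= n)%N -> t k \in `[0, 1]) ->
    (forall k, (k < n)%N -> t k <= t k.+1) ->
  ((\sum_(k < n) (crosses c (complex.Re (gamma (t k)))
                            (complex.Re (gamma (t k.+1))))%:R)%:E <= vf gamma)%E.
Proof.
move=> gamma_curve t01 t_mono.
pose cr k := crosses c (complex.Re (gamma (t k))) (complex.Re (gamma (t k.+1))).
have t_le i j : (i <= j)%N -> (j <= n)%N -> t i <= t j.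
  move=> ij; rewrite -(subnK ij); elim: (j - i)%N => [//|m IH] mn.
  by rewrite addSn (le_trans (IH (ltnW mn)))// t_mono.
have /choice[r rP] : forall k : 'I_n, exists r, cr k ->
    t k < r < t k.+1 /\ is_entry_point gamma (vertical c) r.
  move=> k; have [crk|_] := boolP (cr k); last by exists 0.
  have [|||r kr re] := @vertical_entry gamma c (t k) (t k.+1) gamma_curve _ _ _ crk.
  - by rewrite t01// ltnW.
  - by rewrite t01.
  - by rewrite t_mono.
  by exists r.
have r_inj : {in [pred k : 'I_n | cr k] &, injective r}.
  move=> k l; rewrite !inE => /rP[/andP[kr rk] _] /rP[/andP[lr rl] _] rkl.
  apply: ord_inj; case: (ltngtP k l) => // kl.
    have tkl := t_le _ _ kl (ltnW (ltn_ord _)).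
    by move: (lt_le_trans rk tkl); rewrite rkl ltNge (ltW lr).
  have tlk := t_le _ _ kl (ltnW (ltn_ord _)).
  by move: (lt_le_trans rl tlk); rewrite -rkl ltNge (ltW kr).
apply: (@le_trans _ _ (vf_line gamma (vertical c))); last first.
  by apply: ereal_sup_ubound; exists (vertical c) => //; exact: is_line_vertical.
rewrite /vf_line /counting; case: ifPn => [/asboolP fin|_]; last exact: leey.
rewrite lee_fin -natr_sum ler_nat.
rewrite (eq_bigr (fun k : 'I_n => if cr k then 1%N else 0%N)); last first.
  by move=> k _; rewrite -/(cr k); case: (cr k).
rewrite -big_mkcond/= sum1_card cardE -(size_map r).
apply: uniq_leq_size => [|_ /mapP[k + ->]].
  by rewrite map_inj_in_uniq ?enum_uniq// => k l; rewrite !mem_enum => ? ?; exact: r_inj.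
by rewrite mem_enum => /rP[_ r_entry]; rewrite in_fset_set// mem_set.
Qed.

End Curves.

(** * The BV norm on a subset of the real line *)

Section NonnegativeSupremum.
Variable R : realType.
Implicit Type A : set (\bar R).

Lemma nnsup_ge0 A : (0 <= nnsup A)%E.
Proof. by apply: ereal_sup_ubound; left. Qed.

Lemma nnsup_ub A a : A a -> (a <= nnsup A)%E.
Proof. by move=> Aa; apply: ereal_sup_ubound; right. Qed.

Lemma nnsup_le A b : (0 <= b)%E -> (forall a, A a -> (a <= b)%E) -> (nnsup A <= b)%E.
Proof. by move=> b0 Ab; apply: ge_ereal_sup => a [->//|/Ab]. Qed.

End NonnegativeSupremum.

Section RealSets.
Variable R : realType.
Implicit Types (S : set R) (f g : R -> R[i]) (v M : R).

Definition reals S : set R[i]^o := [set x%:C | x in S].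

Definition res S f : reals S -> R[i] := fun z => f (complex.Re (\val z)).
Arguments res : clear implicits.

Definition ext S (h : reals S -> R[i]) : R -> R[i] :=
  fun x => if insub (x%:C : R[i]^o) is Some z then h z else 0.

Lemma reals_Re S (z : reals S) : S (complex.Re (\val z)) /\
  \val z = (complex.Re (\val z))%:C.
Proof. by have /set_mem[x Sx <-] := valP z. Qed.

Lemma reals_pt S x : S x -> exists z : reals S, \val z = x%:C.
Proof.
by move=> Sx; exists (SigSub (mem_set (ex_intro2 _ _ x Sx erefl : reals S x%:C))).
Qed.

Lemma eq_res S f g : (forall x, S x -> f x = g x) -> res S f = res S g.
Proof. by move=> fg; apply/funext => z; apply: fg; have [] := reals_Re z. Qed.

Lemma res_inj S f g x : res S f = res S g -> S x -> f x = g x.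
Proof.
by move=> fg /reals_pt[z zx]; move/(congr1 (@^~ z)): fg; rewrite /res zx.
Qed.

Lemma extK S (h : reals S -> R[i]) : res S (ext h) = h.
Proof.
apply/funext => z; rewrite /res /ext; have [_ <-] := reals_Re z.
by rewrite valK.
Qed.

Lemma line_through (z : R[i]) : exists2 l : set R[i]^o, is_line l & l z.
Proof.
exists (vertical (complex.Re z)); first exact: is_line_vertical.
by [].
Qed.

Lemma vf_ge1 (gamma : R -> R[i]^o) : (1 <= vf gamma)%E.
Proof.
have [l l_line lz] := line_through (gamma 0).
apply: (@le_trans _ _ (vf_line gamma l)); last first.
  by apply: ereal_sup_ubound; exists l.
rewrite /vf_line /counting; case: ifPn => [/asboolP fin|_]; last exact: leey.
rewrite lee_fin ler1n finmap.cardfs_gt0.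
apply/finmap.fset0Pn; exists 0; rewrite in_fset_set// mem_set//.
by split => //=; [rewrite in_itv/= lexx ler01|left].
Qed.

(** Along a curve [gamma] each level is crossed at most [vf gamma] times, so the
sums along [gamma] are at most [vf gamma] times the variation on the line, and
the weight [rho gamma] cancels this factor. *)
Lemma var_le_var S f v : 0 <= v -> var_le S f v -> (var (res S f) <= v%:E)%E.
Proof.
move=> v0 [w [wv fw]]; apply: nnsup_le; first by rewrite lee_fin.
move=> _ [gamma gamma_curve <-]; rewrite /rho.
have := vf_ge1 gamma; case vfE: (vf gamma) => [N| |] //; last first.
  by move=> _; rewrite invey mul0e lee_fin.
rewrite lee_fin => N1; have N0 : 0 < N by apply: lt_le_trans N1.
rewrite inver (gt_eqF N0) lee_pdivrMl//; apply: nnsup_le.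
  by rewrite -EFinM lee_fin mulr_ge0// ltW.
move=> _ [n [t [s [t01 t_mono st ->]]]]; rewrite -EFinM lee_fin.
pose x k := complex.Re (gamma (t k)).
have Sx k : (k <= n)%N -> S (x k).
  by move=> kn; rewrite /x -st//; have [] := reals_Re (s k).
apply: (@le_trans _ _ (\sum_(k < n) `|w (x k.+1) - w (x k)|)).
  apply: ler_sum => k _; have kn := ltn_ord k; have kn' := ltnW kn.
  rewrite /res !st//; have [xx|/ltW xx] := leP (x k) (x k.+1).
    by rewrite (le_trans (fw _ _ _ _ xx)) ?ler_norm//; exact: Sx.
  by rewrite rdistC distrC (le_trans (fw _ _ _ _ xx)) ?ler_norm//; exact: Sx.
apply: sum_dist_crossings => [|k kn|k l kn ln xkl|c xc].
- exact: ltW.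
- exact/wv/Sx.
- rewrite -subr_ge0 (le_trans (rnorm_ge0 _) (fw _ _ _ _ xkl))//; exact: Sx.
- by rewrite -lee_fin -vfE; exact: crossings_le_vf.
Qed.

Section Segment.
Variables (p q : R) (pq : p < q).

Let gamma (t : R) : R[i]^o := (p + t * (q - p))%:C.

Lemma is_curve_segment : is_curve gamma.
Proof.
apply: continuous_subspaceT => t; apply/cvgrPdist_lt => e.
rewrite ltcE/= => /andP[/eqP e_real e0].
have e'E : e = (complex.Re e)%:C by apply/eqP; rewrite eq_complex/= e_real !eqxx.
have qp0 : 0 < q - p by rewrite subr_gt0.
have : \forall u \near t, `|t - u| < complex.Re e / (q - p).
  by exists (complex.Re e / (q - p)) => //=; rewrite divr_gt0.
apply: filterS => u tu.
rewrite -rmorphB/= normE rnormC e'E ltcR.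
have -> : p + t * (q - p) - (p + u * (q - p)) = (t - u) * (q - p) by ring.
by rewrite normrM (gtr0_norm qp0) -ltr_pdivlMr.
Qed.

(** A line that meets the segment at two times contains all of it, and then only
time 0 is an entry point. *)
Lemma vf_segment : (vf gamma <= 1)%E.
Proof.
apply: ge_ereal_sup => _ [l [a [b [b0 lE]]] <-].
have entry_uniq s t : s < t -> is_entry_point gamma l s ->
    is_entry_point gamma l t -> False.
  move=> st [s01 ls _] [t01 lt [t0|t_entry]].
    by move: s01; rewrite in_itv/= -t0 leNgt st.
  have [u [_ _ lu]] := t_entry 1 ltr01; apply: lu.
  move: ls lt; rewrite lE => -[x _ xs] [y _ yt].
  have xy : y - x != 0.
    rewrite subr_eq0; apply/negP => /eqP xy.
    have : gamma s = gamma t by rewrite -xs -yt xy.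
    move/complexI/addrI/mulIf; rewrite subr_eq0 => /(_ (negbT (gt_eqF pq))) stE.
    by rewrite stE ltxx in st.
  have st0 : t - s != 0 by rewrite subr_eq0 gt_eqF.
  exists (x + (u - s) / (t - s) * (y - x)) => //.
  have -> : gamma u = gamma s + ((u - s) / (t - s))%:C * (gamma t - gamma s).
    by rewrite /gamma -rmorphB -rmorphM -rmorphD/=; congr (_%:C); field.
  by rewrite -xs -yt rmorphD rmorphM rmorphB/=; ring.
have [s_entry|no_entry] := pselect (exists s, is_entry_point gamma l s).
  have [s s_e] := s_entry.
  have -> : vf_line gamma l = counting [set s].
    congr counting; apply/seteqP; split => [t/= t_e|t ->//].
    by have [st|ts|//] := ltgtP s t; exfalso; [apply: entry_uniq st _ _|apply: entry_uniq ts _ _].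
  rewrite /counting asboolT// fset_set1 lee_fin.
  by rewrite (_ : size _ = 1%N) //; exact: finmap.cardfs1.
have -> : vf_line gamma l = counting (set0 : set R).
  by congr counting; apply/seteqP; split => // t t_e; apply: no_entry; exists t.
by rewrite /counting asboolT// fset_set0 lee_fin.
Qed.

End Segment.

(** A nondecreasing sequence lies on the segment from its first to its last
point, which is a curve of weight 1. *)
Lemma var_le_sum S f v : (var (res S f) <= v%:E)%E ->
  forall (n : nat) (x : nat -> R), (forall k, (k <= n)%N -> S (x k)) ->
    (forall k, (k < n)%N -> x k <= x k.+1) ->
  \sum_(k < n) rnorm (f (x k.+1) - f (x k)) <= v.
Proof.
move=> varv n x Sx x_mono.
have v0 : 0 <= v by rewrite -lee_fin (le_trans _ varv)// nnsup_ge0.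
have x_le i j : (i <= j)%N -> (j <= n)%N -> x i <= x j.
  move=> ij; rewrite -(subnK ij); elim: (j - i)%N => [//|m IH] mn.
  by rewrite addSn (le_trans (IH (ltnW mn)))// x_mono.
have [pq|] := ltP (x 0%N) (x n); last first.
  move=> qp; rewrite big1// => k _; have kn := ltn_ord k.
  have xE j : (j <= n)%N -> x j = x 0%N.
    by move=> jn; apply: le_anti; rewrite (le_trans (x_le _ _ jn (leqnn n)) qp) x_le.
  by rewrite (xE _ kn) (xE _ (ltnW kn)) subrr rnorm0.
set p := x 0%N in pq *; set q := x n in pq *.
have qp0 : 0 < q - p by rewrite subr_gt0.
pose gamma (t : R) : R[i]^o := (p + t * (q - p))%:C.
have [s sE] : {s : nat -> reals S & forall k, (k <= n)%N -> \val (s k) = (x k)%:C}.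
  apply: (@choice _ _ (fun k z => (k <= n)%N -> \val z = (x k)%:C)) => k.
  have [kn|_] := boolP (k <= n)%N; first by have [z zE] := reals_pt (Sx k kn); exists z.
  by have [z zE] := reals_pt (Sx 0%N (leq0n n)); exists z.
pose t k := (x k - p) / (q - p).
have gamma_t k : gamma (t k) = (x k)%:C.
  by rewrite /gamma /t divfK ?gt_eqF// addrC subrK.
rewrite -lee_fin (le_trans _ varv)//.
apply: (@le_trans _ _ (rho gamma * cvar (res S f) gamma)%E); last first.
  by apply: nnsup_ub; exists gamma => //; exact: is_curve_segment.
apply: (@le_trans _ _ (cvar (res S f) gamma)); last first.
  rewrite lee_pemull ?nnsup_ge0// inve_ge1 ?vf_segment//.
  by rewrite (le_trans _ (vf_ge1 _)).
apply: nnsup_ub; exists n, t, s; split => [k kn|k kn|k kn|].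
- rewrite in_itv/= /t; apply/andP; split.
    by rewrite divr_ge0 ?(ltW qp0)// subr_ge0 x_le.
  by rewrite ler_pdivrMr// mul1r lerB// x_le.
- by rewrite ler_pM2r ?invr_gt0// lerB// x_mono.
- by rewrite gamma_t sE.
- congr EFin; apply: eq_bigr => k _; have kn := ltn_ord k.
  by rewrite /res !sE// ltnW.
Qed.

(** The dominating function at [y] is the supremum of the sums over the sequences
that end at most at [y]. *)
Lemma sums_var_le S f v : 0 <= v ->
    (forall (n : nat) (x : nat -> R), (forall k, (k <= n)%N -> S (x k)) ->
      (forall k, (k < n)%N -> x k <= x k.+1) ->
      \sum_(k < n) rnorm (f (x k.+1) - f (x k)) <= v) ->
  var_le S f v.
Proof.
move=> v0 sumv.
pose A y := [set r | exists (n : nat) (x : nat -> R),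
  [/\ forall k, (k <= n)%N -> S (x k) /\ x k <= y,
      forall k, (k < n)%N -> x k <= x k.+1 &
      r = \sum_(k < n) rnorm (f (x k.+1) - f (x k))]].
have A0 y : S y -> A y 0.
  by move=> Sy; exists 0%N, (fun=> y); split => //; rewrite big_ord0.
have Av y r : A y r -> r <= v.
  by move=> [n [x [Sx x_mono ->]]]; apply: sumv => // k /Sx[].
have supA y : S y -> has_sup (A y).
  by move=> Sy; split; [exists 0; exact: A0|exists v => r /Av].
exists (fun y => sup (A y)); split => [y Sy|y z Sy Sz yz].
  rewrite sup_upper_bound//=; [|exact: supA|exact: A0].
  by apply: ge_sup; [exists 0; exact: A0|move=> r /Av].
rewrite lerBrDl addrC -lerBrDl; apply: ge_sup; first by exists 0; exact: A0.
move=> r [n [x [Sx x_mono ->]]]; rewrite lerBrDl addrC.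
pose x' k := if (k <= n)%N then x k else if k == n.+1 then y else z.
have x'E k : (k <= n)%N -> x' k = x k by rewrite /x' => ->.
have x'n1 : x' n.+1 = y by rewrite /x' ltnn eqxx.
have x'n2 : x' n.+2 = z by rewrite /x' ltnNge leqnSn/= gtn_eqF.
apply: (@le_trans _ _ (\sum_(k < n.+2) rnorm (f (x' k.+1) - f (x' k)))).
  rewrite !big_ord_recr/= x'n1 x'n2 x'E// lerD2r.
  apply: (@le_trans _ _ (\sum_(k < n) rnorm (f (x' k.+1) - f (x' k)))).
    by apply: ler_sum => k _; have kn := ltn_ord k; rewrite !x'E// ltnW.
  by rewrite lerDl rnorm_ge0.
apply: sup_upper_bound; first exact: supA.
exists n.+2, x'; split => // [k|k].
  rewrite leq_eqVlt => /predU1P[->|]; first by rewrite x'n2.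
  rewrite ltnS leq_eqVlt => /predU1P[->|]; first by rewrite x'n1.
  by rewrite ltnS => kn; rewrite x'E//; have [? /le_trans->] := Sx _ kn.
rewrite ltnS leq_eqVlt => /predU1P[->|]; first by rewrite x'n1 x'n2.
rewrite ltnS leq_eqVlt => /predU1P[->|kn]; last by rewrite !x'E ?x_mono// ltnW.
by rewrite x'n1 x'E//; have [] := Sx n (leqnn n).
Qed.

(** For a subset of the real line the weighted supremum over plane curves is the
classical total variation. *)
Theorem BVnorm_le S f M : (BVnorm (res S f) <= M%:E)%E <-> bv_le S f M.
Proof.
split => [fM|[c [v [c0 v0 cvM fc fv]]]]; last first.
  apply: (@le_trans _ _ (c + v)%:E); last by rewrite lee_fin.
  rewrite EFinD leeD ?var_le_var//; apply: nnsup_le; first by rewrite lee_fin.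
  by move=> _ [z _ <-]; rewrite lee_fin; apply: fc; have [] := reals_Re z.
have supnorm0 : (0 <= supnorm (res S f))%E by exact: nnsup_ge0.
have var0 : (0 <= var (res S f))%E by exact: nnsup_ge0.
have [sup_fin var_fin] : supnorm (res S f) \is a fin_num /\ var (res S f) \is a fin_num.
  split; rewrite ge0_fin_numE//; apply: le_lt_trans (ltry M); apply: le_trans fM.
    by rewrite leeDl.
  by rewrite leeDr.
exists (fine (supnorm (res S f))), (fine (var (res S f))); split.
- exact: fine_ge0.
- exact: fine_ge0.
- by rewrite -lee_fin EFinD !fineK.
- move=> x /reals_pt[z zx]; rewrite -lee_fin fineK//; apply: nnsup_ub.
  by exists z => //; rewrite /res zx.
- apply: sums_var_le; first exact: fine_ge0.
  by apply: var_le_sum; rewrite fineK.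
Qed.

End RealSets.
Arguments res {R} S f z.

(** * Absolutely continuous functions *)

Section AbsolutelyContinuous.
Variable R : realType.
Implicit Types (S : set R) (f g : R -> R[i]) (a b M e : R).

Definition bounded_in S a b := forall x, S x -> a <= x <= b.

(** A one-constructor type rather than an abbreviation: [AC_space] is an
intersection and would unfold to a product over all closed subalgebras. *)
Variant ac S f : Prop := Ac of AC_space (res S f).

Definition id_C (x : R) : R[i] := x%:C.

Lemma lambda_res S : @lambda R (reals S) = res S id_C.
Proof. by apply/funext => z; have [_] := reals_Re z. Qed.

Lemma lambdabar_res S : @lambdabar R (reals S) = res S id_C.
Proof.
by apply/funext => z; rewrite /lambdabar /res; have [_ ->] := reals_Re z; rewrite conjc_real.
Qed.

Lemma eq_ac S f g : ac S f -> (forall x, S x -> f x = g x) -> ac S g.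
Proof. by move=> [fA] fg; constructor; rewrite -(eq_res fg). Qed.

Lemma ac1 S : ac S (cst 1).
Proof. by constructor=> A [_ gen]; apply: gen; constructor 1. Qed.

Lemma ac_id S : ac S id_C.
Proof. by constructor=> A [_ gen]; apply: gen; constructor 2; rewrite lambda_res. Qed.

Lemma acD S f g : ac S f -> ac S g -> ac S (f \+ g).
Proof.
move=> [fA] [gA]; constructor=> A AP; have [[_ AD _ _ _] _] := AP.
exact: (AD _ _ (fA A AP) (gA A AP)).
Qed.

Lemma acZ S c f : ac S f -> ac S (c \*o f).
Proof.
by move=> [fA]; constructor=> A AP; have [[_ _ AZ _ _] _] := AP; exact: (AZ c _ (fA A AP)).
Qed.

Lemma acM S f g : ac S f -> ac S g -> ac S (f \* g).
Proof.
move=> [fA] [gA]; constructor=> A AP; have [[_ _ _ AM _] _] := AP.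
exact: (AM _ _ (fA A AP) (gA A AP)).
Qed.

Lemma ac_cst S c : ac S (cst c).
Proof. by apply: eq_ac (acZ c (ac1 S)) _ => x _ /=; rewrite mulr1. Qed.

Lemma acN S f : ac S f -> ac S (\- f).
Proof. by move=> /(acZ (-1)) fA; apply: eq_ac fA _ => x _ /=; rewrite mulN1r. Qed.

Lemma acB S f g : ac S f -> ac S g -> ac S (f \- g).
Proof. by move=> fA /acN gA; have := acD fA gA. Qed.

Lemma acX S f n : ac S f -> ac S (fun x => f x ^+ n).
Proof.
move=> fA; elim: n => [|n IH]; first exact: ac1.
by apply: eq_ac (acM fA IH) _ => x _ /=; rewrite exprS.
Qed.

Lemma BV_spaceP S f : BV_space (res S f) <-> exists M, bv_le S f M.
Proof.
split => [|[M /BVnorm_le fM]]; last exact: le_lt_trans fM (ltry M).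
rewrite /BV_space/= => f_fin; exists (fine (BVnorm (res S f))).
have f0 : (0 <= BVnorm (res S f))%E by rewrite adde_ge0 ?nnsup_ge0.
by apply/BVnorm_le; rewrite fineK// ge0_fin_numE.
Qed.

Lemma ac_lim S f : (exists M, bv_le S f M) ->
  (forall e, 0 < e -> exists2 g, ac S g & bv_le S (f \- g) e) -> ac S f.
Proof.
move=> /BV_spaceP fBV fg; constructor=> A AP; have [[_ _ _ _ Alim] _] := AP.
apply: Alim => // e e0; have [g gA] := fg (e / 2) ltac:(by rewrite divr_gt0).
have [{}gA] := gA; move=> /BVnorm_le fge; exists (res S g); first exact: gA.
by rewrite (le_lt_trans fge)// lte_fin; lra.
Qed.

Lemma bv_le_id S a b : bounded_in S a b -> exists M, bv_le S id_C M.
Proof.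
move=> Sab; exists (`|a| + `|b| + (Num.max a b - a)).
apply: (@bv_le_nondecreasing _ _ id) => //.
- by rewrite le_max lexx.
- move=> x /Sab /andP[ax xb]; rewrite ler_norml; apply/andP; split.
    by have := ler_norm (- a); rewrite normrN; have := normr_ge0 b; lra.
  by have := ler_norm b; have := normr_ge0 a; lra.
- by move=> x /Sab /andP[-> xb]; rewrite le_max xb orbT.
Qed.

(** The functions that are limits of members of an algebra [Q] of functions of
bounded variation form a closed subalgebra. If [Q] contains the generators, so
does this closed subalgebra, and it then contains AC. *)
Lemma ac_approx S a b (Q : (R -> R[i]) -> Prop) : bounded_in S a b ->
    (forall f, Q f -> exists M, bv_le S f M) -> Q (cst 1) -> Q id_C ->
    (forall f g, Q f -> Q g -> Q (f \+ g)) ->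
    (forall c f, Q f -> Q (c \*o f)) ->
    (forall f g, Q f -> Q g -> Q (f \* g)) ->
  forall f, ac S f -> forall e, 0 < e -> exists2 g, Q g & bv_le S (f \- g) e.
Proof.
move=> Sab Qbv Q1 Qid QD QZ QM.
pose P f := (exists M, bv_le S f M) /\
  (forall e, 0 < e -> exists2 g, Q g & bv_le S (f \- g) e).
have QP f : Q f -> P f.
  move=> Qf; split; first exact: Qbv.
  move=> e e0; exists f => //; apply: (@bv_le_trans _ _ _ 0); first exact: ltW.
  rewrite -(rnorm0 R[i]).
  by apply: eq_bv_le (bv_le_cst S 0) _ => x _; rewrite /= subrr.
have eqP' f g : (forall x, S x -> f x = g x) -> P f -> P g.
  move=> fg [[M fM] fP]; split; first by exists M; exact: eq_bv_le fM fg.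
  move=> e /fP[h Qh fh]; exists h => //; apply: eq_bv_le fh _ => x Sx /=.
  by rewrite fg.
suff closedP : closed_subalgebra [set h | exists2 f, h = res S f & P f].
  move=> f [fA]; have [|g fg Pg] := fA [set h | exists2 f, h = res S f & P f].
    split => // h; case=> ->.
    - by exists (cst 1) => //; exact: QP.
    - by exists id_C; [exact: lambda_res|exact: QP].
    - by exists id_C; [exact: lambdabar_res|exact: QP].
  have [] // : P f by apply: eqP' Pg => x Sx; apply/esym; exact: res_inj fg Sx.
split.
- by move=> _ [f -> [fM _]]; apply/BV_spaceP.
- move=> _ _ [f -> [[M fM] fP]] [g -> [[N gN] gP]]; exists (f \+ g) => //.
  split=> [|e e0]; first by exists (M + N); exact: bv_leD.
  have [f' Qf' ff'] := fP (e / 2) ltac:(by rewrite divr_gt0).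
  have [g' Qg' gg'] := gP (e / 2) ltac:(by rewrite divr_gt0).
  exists (f' \+ g'); first exact: QD.
  rewrite [e]splitr; apply: eq_bv_le (bv_leD ff' gg') _ => x _ /=; ring.
- move=> c _ [f -> [[M fM] fP]]; exists (c \*o f) => //.
  split=> [|e e0]; first by exists (rnorm c * M); exact: bv_leZ.
  have c1 : 0 < rnorm c + 1 by rewrite ltr_wpDl ?rnorm_ge0.
  have [g Qg fg] := fP (e / (rnorm c + 1)) ltac:(by rewrite divr_gt0).
  exists (c \*o g); first exact: QZ.
  apply: (@bv_le_trans _ _ _ (rnorm c * (e / (rnorm c + 1)))).
    by rewrite mulrCA ger_pMr// ler_pdivrMr// mul1r lerDl.
  by apply: eq_bv_le (bv_leZ c fg) _ => x _ /=; ring.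
- move=> _ _ [f -> [[M fM] fP]] [g -> [[N gN] gP]]; exists (f \* g) => //.
  split=> [|e e0]; first by exists (M * N); exact: bv_leM.
  have M0 := bv_le_ge0 fM; have N0 := bv_le_ge0 gN.
  pose d := Num.min 1 (e / (M + N + 1)).
  have k0 : 0 < M + N + 1 by rewrite ltr_wpDl ?addr_ge0.
  have d0 : 0 < d by rewrite lt_min ltr01 divr_gt0.
  have d1 : d <= 1 by rewrite ge_min lexx.
  have dk : d * (M + N + 1) <= e by rewrite -ler_pdivlMr// ge_min lexx orbT.
  have [f' Qf' ff'] := fP d d0; have [g' Qg' gg'] := gP d d0.
  exists (f' \* g'); first exact: QM.
  (* f g - f' g' = (f - f') g + f (g - g') - (f - f') (g - g') *)
  apply: (@bv_le_trans _ _ _ (d * N + M * d + d * d)).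
    by have := ler_wpM2l (ltW d0) d1; lra.
  apply: eq_bv_le
    (bv_leB (bv_leD (bv_leM ff' gN) (bv_leM fM gg')) (bv_leM ff' gg')) _.
  by move=> x _ /=; ring.
- move=> h h_bv h_lim; have hE := esym (extK h); exists (ext h) => //.
  split=> [|e e0]; first by apply/BV_spaceP; rewrite -hE.
  have [_ [f -> [_ fP]] hf] := h_lim (e / 2) ltac:(by rewrite divr_gt0).
  have [g Qg fg] := fP (e / 2) ltac:(by rewrite divr_gt0).
  exists g => //.
  have /BVnorm_le hf' : (BVnorm (res S (ext h \- f)%R) <= (e / 2)%:E)%E.
    by apply/ltW; rewrite hE in hf.
  rewrite [e]splitr; apply: eq_bv_le (bv_leD hf' fg) _ => x _ /=; ring.
Qed.

(** BV is itself a closed subalgebra, and contains the generators because [S] is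
bounded. *)
Lemma ac_bv S a b f : bounded_in S a b -> ac S f -> exists M, bv_le S f M.
Proof.
move=> Sab fA.
have [|||||g [N gN] fg] := @ac_approx S a b (fun f => exists M, bv_le S f M)
    Sab (fun f => id) _ _ _ _ _ f fA 1 ltr01.
- by exists (rnorm (1 : R[i])); exact: bv_le_cst.
- exact: bv_le_id Sab.
- by move=> ? ? [M fM] [N gN]; exists (M + N); exact: bv_leD.
- by move=> c g [M gM]; exists (rnorm c * M); exact: bv_leZ.
- by move=> ? ? [M fM] [N gN]; exists (M * N); exact: bv_leM.
by exists (1 + N); apply: eq_bv_le (bv_leD fg gN) _ => x _ /=; rewrite subrK.
Qed.

(** Composition with a nondecreasing map does not increase the variation, so
AC is stable under composition with the nondecreasing functions it contains. *)
Lemma ac_comp S S' a b (p : R -> R) f : bounded_in S a b ->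
    (forall x, S' x -> S (p x)) ->
    (forall x y, S' x -> S' y -> x <= y -> p x <= p y) ->
    ac S' (id_C \o p) ->
  ac S f -> ac S' (f \o p).
Proof.
move=> Sab pS p_mono pA fA.
have bv_comp g M : bv_le S g M -> bv_le S' (g \o p) M by exact: bv_le_comp.
apply: ac_lim => [|e e0].
  by have [M fM] := ac_bv Sab fA; exists M; exact: bv_comp.
have [||||||g [gA _] fg] := @ac_approx S a b (fun g => ac S' (g \o p) /\
    exists M, bv_le S g M) Sab _ _ _ _ _ _ f fA e e0.
- by move=> g [].
- split; first exact: ac1.
  by exists (rnorm (1 : R[i])); exact: bv_le_cst.
- by split => //; exact: bv_le_id Sab.
- move=> ? ? [fA' [M fM]] [gA [N gN]]; split; first exact: acD.
  by exists (M + N); exact: bv_leD.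
- move=> c g [gA [M gM]]; split; first exact: acZ.
  by exists (rnorm c * M); exact: bv_leZ.
- move=> ? ? [fA' [M fM]] [gA [N gN]]; split; first exact: acM.
  by exists (M * N); exact: bv_leM.
by exists (g \o p) => //; have := bv_comp _ _ fg.
Qed.

Lemma ac_subset S S' a b f : bounded_in S a b -> S' `<=` S -> ac S f -> ac S' f.
Proof.
by move=> Sab S'S; apply: (@ac_comp _ _ _ _ id f Sab) => //; exact: ac_id.
Qed.

End AbsolutelyContinuous.
Arguments id_C {R} x.

(** * Absolute values and clamps *)

Section AbsoluteValue.
Variable R : realType.
Implicit Types (S : set R) (f g : R -> R[i]) (a b c d e p q s t x : R).

(** The classical polynomial iteration towards [t], but started from 1 instead
of 0: it then decreases to [t] and the error is monotone in [t], so the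
variation of the error is its maximum. *)
Fixpoint abs_approx (n : nat) t : R :=
  if n is m.+1 then abs_approx m t + (t ^+ 2 - abs_approx m t ^+ 2) / 2 else 1.

(** The error [d = u - t] obeys [d' = d * (1 - (u + t) / 2)], a product of
nonnegative nonincreasing functions of [t] when [d] is one and [u] is
nondecreasing; at [t = 0] it obeys [d' = d - d ^ 2 / 2]. *)
Lemma abs_approxP n :
  [/\ forall t, 0 <= t <= 1 -> t <= abs_approx n t <= 1,
      forall s t, 0 <= s -> s <= t -> t <= 1 -> abs_approx n s <= abs_approx n t,
      forall s t, 0 <= s -> s <= t -> t <= 1 ->
        abs_approx n t - t <= abs_approx n s - s &
      abs_approx n 0 <= 2 / n.+2%:R].
Proof.
elim: n => [|n [u_itv u_mono d_mono u0]].
  by split => /= [t ?|s t ? ? ?|s t ? ? ?|]; [lra|lra|lra|rewrite divff].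
split => /=.
- move=> t t01; have := u_itv t t01; set u := abs_approx n t => tu1.
  have -> : u + (t ^+ 2 - u ^+ 2) / 2 = t + (u - t) * (1 - (u + t) / 2) by field.
  have ut0 : 0 <= (u - t) * (1 - (u + t) / 2) by apply: mulr_ge0; lra.
  have : (u - t) * (1 - (u + t) / 2) <= (u - t) * 1 by apply: ler_wpM2l; lra.
  by lra.
- move=> s t s0 st t1; have := u_mono _ _ s0 st t1.
  have := u_itv s ltac:(lra); have := u_itv t ltac:(lra).
  set u := abs_approx n s; set v := abs_approx n t => tv su uv.
  rewrite -subr_ge0.
  have -> : v + (t ^+ 2 - v ^+ 2) / 2 - (u + (s ^+ 2 - u ^+ 2) / 2) =
      (v - u) * (1 - (u + v) / 2) + (t - s) * ((t + s) / 2) by field.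
  by apply: addr_ge0; apply: mulr_ge0; lra.
- move=> s t s0 st t1; have := u_mono _ _ s0 st t1; have := d_mono _ _ s0 st t1.
  have := u_itv s ltac:(lra); have := u_itv t ltac:(lra).
  set u := abs_approx n s; set v := abs_approx n t => tv su duv uv.
  have -> : v + (t ^+ 2 - v ^+ 2) / 2 - t = (v - t) * (1 - (v + t) / 2) by field.
  have -> : u + (s ^+ 2 - u ^+ 2) / 2 - s = (u - s) * (1 - (u + s) / 2) by field.
  by apply: ler_pM; lra.
- have := u_itv 0 ltac:(lra); move: u0; set u := abs_approx n 0 => u0 u01.
  have n0 : 0 < n.+2%:R :> R by rewrite ltr0n.
  have n2 : 2 <= n.+2%:R :> R by rewrite ler_nat.
  have -> : u + (0 ^+ 2 - u ^+ 2) / 2 = u - u ^+ 2 / 2 by field.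
  apply: (@le_trans _ _ (2 / n.+2%:R - (2 / n.+2%:R) ^+ 2 / 2)).
    rewrite -subr_ge0; set v := 2 / n.+2%:R in u0 *.
    have -> : v - v ^+ 2 / 2 - (u - u ^+ 2 / 2) = (v - u) * (1 - (u + v) / 2).
      by field.
    have v1 : v <= 1 by rewrite ler_pdivrMr// mul1r.
    by apply: mulr_ge0; lra.
  rewrite -[n.+3]addn1 natrD; set m := n.+2%:R in n0 n2 *.
  rewrite -subr_ge0.
  have -> : 2 / (m + 1) - (2 / m - (2 / m) ^+ 2 / 2) = 2 / (m ^+ 2 * (m + 1)).
    by field; apply/andP; split; apply/eqP; lra.
  by rewrite divr_ge0// mulr_ge0 ?sqr_ge0//; lra.
Qed.

(** The error of the polynomial approximation of [|x - c|] is a monotone function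
of [|x - c|], hence monotone on either side of [c]. Uniform smallness of the
error is therefore smallness in norm. *)
Lemma ac_abs S a b c : bounded_in S a b -> ac S (fun x => `|x - c|%:C).
Proof.
move=> Sab; pose B := `|a| + `|b| + `|c| + 1.
have B0 : 0 < B by rewrite ltr_wpDl ?addr_ge0.
have SB x : S x -> 0 <= `|x - c| / B <= 1.
  move=> /Sab /andP[ax xb]; rewrite divr_ge0 ?(ltW B0)//= ler_pdivrMr// mul1r.
  rewrite ler_norml /B; have := ler_norm (- a); have := ler_norm b.
  have := ler_norm c; have := ler_norm (- c); rewrite !normrN.
  by have := normr_ge0 a; have := normr_ge0 b; lra.
have u_ac n : ac S (fun x => (abs_approx n (`|x - c| / B))%:C).
  elim: n => [|n IH] /=; first exact: ac_cst.
  have t_ac := acZ (B^-1)%:C (acB (ac_id S) (ac_cst S c%:C)).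
  have := acD IH (acZ (2^-1)%:C (acB (acM t_ac t_ac) (acM IH IH))).
  move=> /eq_ac; apply=> x _ /=; rewrite /id_C -!rmorphB -!rmorphM -!rmorphB/=.
  rewrite -!rmorphM -!rmorphD/=; congr (_%:C).
  have -> : (`|x - c| / B) ^+ 2 = (B^-1 * (x - c)) * (B^-1 * (x - c)).
    by rewrite expr_div_n real_normK ?num_real// expr2 invrM ?unitfE ?gt_eqF//; ring.
  by ring.
suff approx e : 0 < e -> exists2 g, ac S g & bv_le S ((fun x => `|x - c|%:C) \- g) e.
  apply: ac_lim => //; have [g gA fg] := approx 1 ltr01.
  have [M gM] := ac_bv Sab gA; exists (1 + M).
  by apply: eq_bv_le (bv_leD fg gM) _ => x _ /=; rewrite subrK.
(* the error is at most 5 * B * d in norm, where d <= 2 / (n + 2) *)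
move=> e0; have eB : 0 <= 10 * B / e by rewrite divr_ge0 ?(ltW e0)// mulr_ge0// ltW.
pose n := Num.bound (10 * B / e); have := archi_boundP eB; rewrite -/n => nP.
have [u_itv _ d_mono u0] := abs_approxP n.
pose D t := abs_approx n t - t; pose d := abs_approx n 0.
have D_itv t : 0 <= t <= 1 -> 0 <= D t <= d.
  move=> t01; rewrite subr_ge0; have := u_itv t t01 => /andP[-> _]/=.
  by have := d_mono 0 t (lexx 0); rewrite /D /d => /(_ ltac:(lra) ltac:(lra)); lra.
have d0 : 0 <= d by have := D_itv 0 ltac:(lra); lra.
pose l x := Num.max (c - x) 0 / B; pose r x := Num.max (x - c) 0 / B.
have lr x : S x -> [/\ 0 <= l x <= 1, 0 <= r x <= 1 &
    D (`|x - c| / B) = D (l x) + D (r x) - d].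
  move=> Sx; have := SB x Sx; rewrite /l /r /d; have [xc|cx] := leP c x.
    have -> : Num.max (c - x) 0 = 0 by rewrite max_r// subr_le0.
    have -> : Num.max (x - c) 0 = x - c by rewrite max_l// subr_ge0.
    rewrite ger0_norm ?subr_ge0// mul0r lexx ler01 => xcB.
    by split => //; rewrite /D; ring.
  have -> : Num.max (c - x) 0 = c - x by rewrite max_l// subr_ge0 ltW.
  have -> : Num.max (x - c) 0 = 0 by rewrite max_r// subr_le0 ltW.
  rewrite ltr0_norm ?subr_lt0// opprB mul0r lexx ler01 => xcB.
  by split => //; rewrite /D; ring.
have Dl : bv_le S (fun x => (D (l x))%:C) (d + (d - 0)).
  apply: (@bv_le_nondecreasing _ _ (fun x => D (l x))) => //.
  - move=> x /lr[/D_itv/andP[D0 Dd] _ _]; rewrite ger0_norm//.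
  - by move=> x /lr[/D_itv].
  - move=> x y /lr[lx _ _] /lr[ly _ _] xy; apply: d_mono; [lra| |lra].
    rewrite ler_pM2r ?invr_gt0// ge_max !le_max lexx orbT andbT.
    by apply/orP; left; lra.
have Dr : bv_le S (fun x => (D (r x))%:C) (d + (d - 0)).
  apply: (@bv_le_nonincreasing _ _ (fun x => D (r x))) => //.
  - move=> x /lr[_ /D_itv/andP[D0 Dd] _]; rewrite ger0_norm//.
  - by move=> x /lr[_ /D_itv].
  - move=> x y /lr[_ rx _] /lr[_ ry _] xy; apply: d_mono; [lra| |lra].
    rewrite ler_pM2r ?invr_gt0// ge_max !le_max lexx orbT andbT.
    by apply/orP; left; lra.
exists (B%:C \*o (fun x => (abs_approx n (`|x - c| / B))%:C)).
  exact: acZ.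
have := bv_leN (bv_leZ B%:C (bv_leB (bv_leD Dl Dr) (bv_le_cst S d%:C))).
rewrite !rnormC (gtr0_norm B0) (ger0_norm d0) => Dbv.
apply: (@bv_le_trans _ _ _ (B * (d + (d - 0) + (d + (d - 0)) + d))).
  have n2 : 0 < n.+2%:R :> R by rewrite ltr0n.
  have -> : B * (d + (d - 0) + (d + (d - 0)) + d) = B * (5 * d) by ring.
  apply: (@le_trans _ _ (B * (5 * (2 / n.+2%:R)))).
    by apply: ler_wpM2l; [exact: ltW|rewrite ler_pM2l].
  have -> : B * (5 * (2 / n.+2%:R)) = 10 * B / n.+2%:R by field; apply/eqP; lra.
  rewrite ler_pdivrMr// -ler_pdivrMl// mulrC (le_trans (ltW nP))//.
  by rewrite ler_nat -addn2 leq_addr.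
apply: eq_bv_le Dbv _ => x Sx /=; have [_ _ DE] := lr x Sx.
rewrite -rmorphD -rmorphB -rmorphM -rmorphN -rmorphM -rmorphB/=; congr (_%:C).
by rewrite -DE /D mulrBr opprB mulrCA divff ?gt_eqF// mulr1.
Qed.

End AbsoluteValue.

Section Clamp.
Variable R : realType.
Implicit Types (S : set R) (f : R -> R[i]) (a b p q x y : R).

Definition clamp p q x := Num.max p (Num.min q x).

Lemma clamp_itv p q x : p <= q -> p <= clamp p q x <= q.
Proof. by move=> pq; rewrite /clamp le_max lexx ge_max pq ge_min lexx. Qed.

Lemma clamp_mono p q x y : x <= y -> clamp p q x <= clamp p q y.
Proof.
move=> xy; rewrite /clamp ge_max !le_max lexx/=; apply/orP; right.
by rewrite le_min !ge_min lexx xy !orbT.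
Qed.

Lemma clamp_left p q x : x <= p -> clamp p q x = p.
Proof. by move=> xp; rewrite /clamp max_l// ge_min xp orbT. Qed.

Lemma clamp_right p q x : p <= q -> q <= x -> clamp p q x = q.
Proof. by move=> pq qx; rewrite /clamp min_l// max_r. Qed.

Lemma clamp_id p q x : p <= x <= q -> clamp p q x = x.
Proof. by move=> /andP[px xq]; rewrite /clamp min_r// max_r. Qed.

Variant clamp_spec p q x : R -> Type :=
| ClampLeft of x <= p : clamp_spec p q x p
| ClampIn of p <= x & x <= q : clamp_spec p q x x
| ClampRight of q <= x : clamp_spec p q x q.

Lemma clampP p q x : p <= q -> clamp_spec p q x (clamp p q x).
Proof.
move=> pq; have [xp|/ltW px] := leP x p; first by rewrite clamp_left//; constructor.
have [xq|/ltW qx] := leP x q; first by rewrite clamp_id ?px//; constructor.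
by rewrite clamp_right//; constructor.
Qed.

Lemma clamp_lip p q x y : p <= q -> `|clamp p q x - clamp p q y| <= `|x - y|.
Proof.
move=> pq; have := ler_norm (x - y); have := ler_norm (- (x - y)); rewrite normrN.
by rewrite ler_norml; case: (clampP x pq); case: (clampP y pq); lra.
Qed.

Lemma ac_clamp S a b p q : bounded_in S a b -> p <= q -> ac S (id_C \o clamp p q).
Proof.
move=> Sab pq.
have pA := acD (acB (ac_id S) (ac_cst S p%:C)) (ac_abs p Sab).
have qA := acD (acB (ac_id S) (ac_cst S q%:C)) (ac_abs q Sab).
(* clamp p q x = p + (x - p)^+ - (x - q)^+ *)
apply: eq_ac (acD (ac_cst S p%:C) (acZ (2^-1)%:C (acB pA qA))) _ => x _ /=.
rewrite /id_C -!rmorphB -!rmorphD/= -rmorphB -rmorphM -rmorphD/=; congr (_%:C).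
case: (clampP x pq) => [xp|px xq|qx].
- by rewrite (@ler0_norm _ (x - p)) ?(@ler0_norm _ (x - q)); lra.
- by rewrite (@ger0_norm _ (x - p)) ?(@ler0_norm _ (x - q)); lra.
- by rewrite (@ger0_norm _ (x - p)) ?(@ger0_norm _ (x - q)); lra.
Qed.

Lemma clamp_segment a b p q x : p <= b -> a <= q -> a <= x <= b ->
  a <= clamp p q x <= b.
Proof.
move=> pb aq axb; rewrite /clamp ge_max !le_max !le_min !ge_min.
by have /andP[-> ->] := axb; rewrite pb aq !orbT.
Qed.

End Clamp.

(** * Resolvent functions on a segment *)

Section Segment.
Variable R : realType.
Implicit Types (f : R -> R[i]) (a b p q x y : R) (z : R[i]).

Definition seg a b : set R := [set x | a <= x <= b].

Lemma seg_bounded a b : bounded_in (seg a b) a b.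
Proof. by []. Qed.

Lemma ac_comp_clamp a b p q f : p <= q -> p <= b -> a <= q ->
  ac (seg a b) f -> ac (seg a b) (f \o clamp p q).
Proof.
move=> pq pb aq; apply: (ac_comp (@seg_bounded a b)) => [x|x y _ _|].
- exact: clamp_segment.
- exact: clamp_mono.
- exact: ac_clamp (@seg_bounded a b) pq.
Qed.

Lemma dist2_segment_gt0 a b z : ~ reals (seg a b) z -> exists2 d : R, 0 < d &
  forall x, seg a b x -> d <= (x - complex.Re z) ^+ 2 + complex.Im z ^+ 2.
Proof.
move=> zS; have [z_real|z_im] := eqVneq (complex.Im z) 0; last first.
  exists (complex.Im z ^+ 2); first by rewrite exprn_even_gt0.
  by move=> x _; rewrite lerDr sqr_ge0.
have [za|az] := ltP (complex.Re z) a.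
  exists ((a - complex.Re z) ^+ 2); first by rewrite exprn_gt0// subr_gt0.
  move=> x /andP[ax _]; rewrite z_real expr0n/= addr0 ler_pXn2r// ?nnegrE; lra.
have [bz|zb] := ltP b (complex.Re z).
  exists ((complex.Re z - b) ^+ 2); first by rewrite exprn_gt0// subr_gt0.
  move=> x /andP[_ xb]; rewrite z_real expr0n/= addr0 -[leRHS]sqrrN.
  by rewrite ler_pXn2r// ?nnegrE; lra.
exfalso; apply: zS; exists (complex.Re z); first exact/andP.
by apply/eqP; rewrite eq_complex/= z_real !eqxx.
Qed.

Lemma geometric_small (q e : R) : 0 <= q -> q < 1 -> 0 < e ->
  exists n : nat, q ^+ n <= e.
Proof.
move=> q0 q1 e0; have : `|q| < 1 by rewrite ger0_norm.
move=> /cvg_expr/cvgrPdist_le/(_ e e0)[n _ nP]; exists n.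
by have := nP n (leqnn n); rewrite /= sub0r normrN ger0_norm// exprn_ge0.
Qed.

(** The variation of [f ^ n] is at most [n * q ^ (n - 1) * v]; any [q' > q] absorbs
the factor [n]. *)
Lemma powers_var_le (S : set R) f (q q' v : R) : 0 <= q -> q < q' -> 0 <= v ->
    (forall x, S x -> rnorm (f x) <= q) -> var_le S f v ->
  forall n, (forall x, S x -> rnorm (f x ^+ n) <= q ^+ n) /\
    var_le S (fun x => f x ^+ n) (v / (q' - q) * q' ^+ n).
Proof.
move=> q0 qq' v0 fq fv; have d0 : 0 < q' - q by rewrite subr_gt0.
have q'0 : 0 <= q' by rewrite (le_trans q0)// ltW.
elim => [|n [IHq IHv]].
  split=> [x _|]; first by rewrite !expr0 rnorm1.
  exists (cst 0); split => [x _|x y _ _ _] /=.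
    by rewrite lexx mulr_ge0// divr_ge0// ltW.
  by rewrite !subrr rnorm0.
split => [x Sx|]; first by rewrite !exprS rnormM ler_pM ?rnorm_ge0 ?fq ?IHq.
have -> : (fun x => f x ^+ n.+1) = f \* (fun x => f x ^+ n).
  by apply/funext => x; rewrite /= exprS.
apply: var_le_trans (var_leM q0 (exprn_ge0 n q0) fq IHq fv IHv).
rewrite (@le_trans _ _ (v * q' ^+ n + q * (v / (q' - q) * q' ^+ n)))//.
  by rewrite lerD2r ler_wpM2l// lerXn2r// ltW.
rewrite exprS le_eqVlt; apply/orP; left; apply/eqP; field.
by rewrite gt_eqF.
Qed.

(** Multiplying by the conjugate of [z - x], it suffices to invert
[h = |z - x| ^ 2]. Since [0 < d <= h <= B] on the segment, [h / B = 1 - u] with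
[0 <= u <= 1 - d / B], and the geometric series of [u] converges in norm. *)
Lemma ac_resolvent a b z : ~ reals (seg a b) z ->
  ac (seg a b) (fun x => (z - x%:C)^-1).
Proof.
move=> zS; have [d d0 dP] := dist2_segment_gt0 zS.
set al := complex.Re z in dP; set be := complex.Im z in dP.
pose h x : R := (x - al) ^+ 2 + be ^+ 2.
pose X := `|a| + `|b| + `|al|.
pose B := X ^+ 2 + be ^+ 2 + d.
have B0 : 0 < B by rewrite ltr_wpDl ?addr_ge0 ?sqr_ge0.
have hB x : seg a b x -> h x <= B.
  move=> /andP[ax xb]; rewrite /h /B -[leLHS]addr0 lerD ?(ltW d0)// lerD2r.
  rewrite -[leLHS]real_normK ?num_real// ler_pXn2r ?nnegrE ?addr_ge0//.
  rewrite ler_norml /X; have := ler_norm (- a); have := ler_norm b.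
  have := ler_norm al; have := ler_norm (- al); rewrite !normrN.
  by have := normr_ge0 a; have := normr_ge0 b; lra.
have h_ac : ac (seg a b) (fun x => (h x)%:C).
  have xa := acB (ac_id (seg a b)) (ac_cst _ al%:C).
  apply: eq_ac (acD (acM xa xa) (ac_cst _ (be ^+ 2)%:C)) _ => x _ /=.
  by rewrite /h /id_C -rmorphB -rmorphM -rmorphD/= -expr2.
pose u x := 1 - (h x)%:C / B%:C.
have u_ac : ac (seg a b) u.
  apply: eq_ac (acB (ac1 _) (acZ B%:C^-1 h_ac)) _ => x _ /=.
  by rewrite mulrC.
pose q := 1 - d / B; pose q' := 1 - d / B / 2.
have dB : 0 < d / B by rewrite divr_gt0.
have dB1 : d / B <= 1.
  by rewrite ler_pdivrMr// mul1r /B lerDr addr_ge0 ?sqr_ge0.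
have uq x : seg a b x -> rnorm (u x) <= q.
  move=> Sx; rewrite /u /q -fmorphV -rmorphM -[1]/(1%:C) -rmorphB rnormC/=.
  have h1 : h x / B <= 1 by rewrite ler_pdivrMr// mul1r hB.
  rewrite ger0_norm ?subr_ge0// lerD2l lerN2 ler_pM2r ?invr_gt0//; exact: dP.
have [_ [c [v [c0 v0 _ _ u_v]]]] := ac_bv (@seg_bounded a b) u_ac.
have h0 x : seg a b x -> h x != 0 by move=> /dP dh; rewrite gt_eqF// (lt_le_trans d0).
pose r x : R[i] := ((h x)^-1)%:C.
have [N r_N] : exists N, bv_le (seg a b) r N.
  have [_ [_ [v' [_ v'0 _ _ [w [wv hw]]]]]] := ac_bv (@seg_bounded a b) h_ac.
  have d2 : 0 < d ^+ 2 by rewrite exprn_gt0.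
  exists (d^-1 + v' / d ^+ 2), d^-1, (v' / d ^+ 2); split => //.
  - by rewrite invr_ge0 ltW.
  - by rewrite divr_ge0// ltW.
  - move=> x Sx; rewrite rnormC ger0_norm ?invr_ge0 ?lef_pV2 ?posrE//.
    + exact: dP.
    + by rewrite (lt_le_trans d0)// dP.
    + by rewrite (le_trans (ltW d0))// dP.
  - exists (fun x => w x / d ^+ 2); split => [x /wv/andP[w0 wv']|x y Sx Sy xy].
      by rewrite divr_ge0 ?(ltW d2)//= ler_pM2r ?invr_gt0.
    rewrite -rmorphB rnormC -mulrBl ler_pdivlMr//.
    have -> : (h y)^-1 - (h x)^-1 = - (h y - h x) / (h x * h y).
      by field; rewrite !h0.
    have hxy : d ^+ 2 <= h x * h y by rewrite expr2 ler_pM ?(ltW d0)// dP.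
    have hxy0 : 0 < h x * h y by rewrite (lt_le_trans d2).
    rewrite normrM normrN normfV (gtr0_norm hxy0) mulrAC ler_pdivrMr//.
    have := hw x y Sx Sy xy; rewrite -rmorphB rnormC => hwxy.
    by rewrite ler_pM ?(ltW d2).
have r_ac : ac (seg a b) r.
  apply: ac_lim => [|e e0]; first by exists N.
  pose C := 1 + v / (q' - q).
  have N0 := bv_le_ge0 r_N.
  have qq' : q < q' by rewrite /q /q'; lra.
  have C0 : 0 < C by rewrite ltr_pwDl// divr_ge0// subr_ge0 ltW.
  have CN : 0 < C * (N + 1) by rewrite mulr_gt0// ltr_wpDl.
  have [] := @geometric_small q' (e / (C * (N + 1))).
  - by rewrite /q'; lra.
  - by rewrite /q'; lra.
  - by rewrite divr_gt0.
  move=> n q'n; have q0 : 0 <= q by rewrite /q; lra.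
  have [un_q un_v] := powers_var_le q0 qq' v0 uq u_v n.
  have un_bv : bv_le (seg a b) (fun x => u x ^+ n) (C * q' ^+ n).
    exists (q ^+ n), (v / (q' - q) * q' ^+ n); split => //.
    - exact: exprn_ge0.
    - by rewrite mulr_ge0 ?exprn_ge0 ?divr_ge0 ?subr_ge0 ?(ltW qq')//; lra.
    - by rewrite /C mulrDl mul1r lerD2r lerXn2r// ?nnegrE ?ltW//; lra.
  exists (B%:C^-1 \*o (fun x => \sum_(k < n) u x ^+ k)).
    apply: acZ; elim: (n) => [|m IH].
      by apply: eq_ac (ac_cst _ 0) _ => x _ /=; rewrite big_ord0.
    by apply: eq_ac (acD IH (acX m u_ac)) _ => x _ /=; rewrite big_ord_recr.
  apply: (@bv_le_trans _ _ _ (C * q' ^+ n * N)).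
    rewrite mulrAC; apply: (@le_trans _ _ (C * (N + 1) * q' ^+ n)).
      rewrite ler_wpM2r// ?exprn_ge0//; first by rewrite (le_trans q0)// ltW.
      by rewrite ler_wpM2l ?(ltW C0)// lerDl.
    by rewrite mulrC -ler_pdivlMr.
  apply: eq_bv_le (bv_leM un_bv r_N) _ => x Sx /=.
  have hx0 : (h x)%:C != 0 by rewrite fmorph_eq0 h0.
  have B0' : B%:C != 0 by rewrite fmorph_eq0 gt_eqF.
  have := subrX1 (u x) n; set s := \sum_(k < n) _ => unE.
  have -> : u x ^+ n = 1 + (u x - 1) * s by rewrite -unE; ring.
  by rewrite /r fmorphV/= /u; field; rewrite ?hx0 ?B0'.
apply: eq_ac (acM (acB (ac_cst _ z^*) (ac_id _)) r_ac) _ => x Sx /=.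
have zx : (z - x%:C) * (z^* - x%:C) = (h x)%:C.
  rewrite /h /al /be; case: (z) => y t /=.
  by apply/eqP; rewrite eq_complex/=; apply/andP; split; apply/eqP; ring.
have hx0 : (h x)%:C != 0 by rewrite fmorph_eq0 h0.
have -> : r x = ((h x)%:C)^-1 by rewrite /r fmorphV.
rewrite -zx /id_C invfM mulrCA mulfV ?mulr1//.
by apply: contraNneq hx0 => zx0; rewrite -zx zx0 mulr0.
Qed.

End Segment.

(** * Functional calculi *)

Section Calculus.
Variables (R : realType) (X : completeNormedModType R[i]).
Implicit Types (S : set R) (T : {linear X -> X}) (f g : R -> R[i]).
Implicit Types (Psi : (R -> R[i]) -> {linear X -> X}) (a b K M : R) (x : X).

(** Functions on [S] are represented by functions on the whole line. The bound [K]
is a parameter because the restriction argument preserves it. *)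
Record calculus S T Psi K : Prop := Calculus {
  calc_ge0 : 0 <= K;
  calcD : forall f g x, ac S f -> ac S g -> Psi (f \+ g) x = Psi f x + Psi g x;
  calcZ : forall c f x, ac S f -> Psi (c \*o f) x = c *: Psi f x;
  calcM : forall f g x, ac S f -> ac S g -> Psi (f \* g) x = Psi f (Psi g x);
  calc1 : forall x, Psi (cst 1) x = x;
  calc_id : forall x, Psi id_C x = T x;
  calc_bound : forall f M, ac S f -> bv_le S f M ->
    forall x, rnorm (Psi f x) <= K * M * rnorm x
}.

Lemma calcB S T Psi K : calculus S T Psi K -> forall f g x,
  ac S f -> ac S g -> Psi (f \- g) x = Psi f x - Psi g x.
Proof.
move=> calc f g x fA gA; have -> : f \- g = f \+ (-1 \*o g).
  by apply/funext => y /=; rewrite mulN1r.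
by rewrite (calcD calc)//; [rewrite (calcZ calc)// scaleN1r|exact: acZ].
Qed.

Lemma calc_eq0 S T Psi K : calculus S T Psi K -> forall f x,
  ac S f -> (forall y, S y -> f y = 0) -> Psi f x = 0.
Proof.
move=> calc f x fA f0; apply: rnorm_eq0.
have f_bv : bv_le S f 0.
  by rewrite -(rnorm0 R[i]); apply: eq_bv_le (bv_le_cst S 0) _ => y /f0.
by have := calc_bound calc fA f_bv x; rewrite mulr0 mul0r.
Qed.

Lemma calc_eq S T Psi K : calculus S T Psi K -> forall f g x,
  ac S f -> ac S g -> (forall y, S y -> f y = g y) -> Psi f x = Psi g x.
Proof.
move=> calc f g x fA gA fg; apply/eqP; rewrite -subr_eq0 -(calcB calc)//.
apply/eqP; apply: (calc_eq0 calc); first exact: acB.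
by move=> y /fg /= ->; rewrite subrr.
Qed.

Lemma calc_continuous S a b T Psi K : bounded_in S a b -> calculus S T Psi K ->
  forall f, ac S f -> continuous (Psi f).
Proof.
move=> Sab calc f fA; have [M fM] := ac_bv Sab fA.
exact: rbound_continuous (calc_bound calc fA fM).
Qed.

Lemma opnorm_le (A : {linear X -> X}) M x : (opnorm A <= M%:E)%E ->
  rnorm (A x) <= M * rnorm x.
Proof.
move=> AM; have [->|x0] := eqVneq x 0; first by rewrite linear0 !rnorm0 mulr0.
have rx0 : 0 < rnorm x by rewrite -ltcR -normE normr_gt0.
pose c : R[i] := ((rnorm x)^-1)%:C.
have rc : rnorm c = (rnorm x)^-1 by rewrite rnormC ger0_norm// invr_ge0 ltW.
have : ((rnorm (A (c *: x)))%:E <= M%:E)%E.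
  apply: le_trans AM; apply: nnsup_ub; exists (c *: x) => //=.
  by rewrite rnormZ rc mulVf ?gt_eqF.
by rewrite lee_fin linearZ rnormZ rc ler_pdivrMl// mulrC.
Qed.

(** Every function on [S] extends to the line, and by the norm bound a calculus
depends on the values on [S] only. *)
Lemma AC_operator_calculus S a b T : bounded_in S a b ->
  AC_operator (reals S) T <-> exists Psi K, calculus S T Psi K.
Proof.
move=> Sab; split.
  move=> [psi [[[psi_cont psiD psiZ psiM psi1] [K psiK]] psi_id]].
  exists (fun f => psi (res S f)), `|K|; split => //.
  - by move=> f g x [fA] [gA]; exact: psiD.
  - by move=> c f x [fA]; exact: psiZ.
  - by move=> f g x [fA] [gA]; exact: psiM.
  - by move=> x; rewrite -lambda_res psi_id.
  - move=> f M [fA] /BVnorm_le fM x; apply: opnorm_le.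
    apply: (le_trans (psiK _ fA)).
    have BV0 : (0 <= BVnorm (res S f))%E by rewrite adde_ge0 ?nnsup_ge0.
    rewrite EFinM (le_trans (lee_wpmul2r BV0 (_ : K%:E <= `|K|%:E)%E))//.
      by rewrite lee_fin ler_norm.
    by rewrite lee_wpmul2l// lee_fin.
move=> [Psi [K calc]]; exists (fun h => Psi (ext h)).
have ext_ac (h : reals S -> R[i]) : AC_space h -> ac S (ext h) by move=> hA; constructor; rewrite extK.
have extE (h : reals S -> R[i]) f y : h = res S f -> S y -> ext h y = f y.
  by move=> hf; apply: res_inj; rewrite extK.
split; last first.
  move=> x; rewrite -(calc_id calc); apply: (calc_eq calc).
  - by apply: ext_ac; rewrite lambda_res; have [] := ac_id S.
  - exact: ac_id.
  - by move=> y; apply: extE; exact: lambda_res.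
split; last first.
  exists K => h hA; have hS := ext_ac _ hA; have [M hM] := ac_bv Sab hS.
  have BV0 : (0 <= BVnorm h)%E by rewrite adde_ge0 ?nnsup_ge0.
  have BVfin : BVnorm h \is a fin_num.
    rewrite ge0_fin_numE//; move/BVnorm_le: hM; rewrite extK => hM.
    exact: le_lt_trans hM (ltry M).
  have /BVnorm_le {}hM : (BVnorm (res S (ext h)) <= (fine (BVnorm h))%:E)%E.
    by rewrite extK fineK.
  rewrite -(fineK BVfin) -EFinM; apply: nnsup_le.
    by rewrite lee_fin mulr_ge0 ?(calc_ge0 calc)// (bv_le_ge0 hM).
  move=> _ [x x1 <-]; rewrite lee_fin (le_trans (calc_bound calc hS hM x))//.
  rewrite -[leRHS]mulr1 ler_wpM2l// mulr_ge0 ?(calc_ge0 calc)//.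
  exact: bv_le_ge0 hM.
split.
- by move=> h /ext_ac; exact: calc_continuous Sab calc _.
- move=> h k /ext_ac hA /ext_ac kA x; rewrite -[RHS](calcD calc)//.
  have E y : S y -> ext (h \+ k) y = (ext h \+ ext k) y.
    by apply: extE; transitivity (res S (ext h) \+ res S (ext k)); [rewrite !extK|].
  apply: (calc_eq calc) => //; last exact: acD hA kA.
  by apply: eq_ac (acD hA kA) _ => y /E.
- move=> c h /ext_ac hA x; rewrite -[RHS](calcZ calc)//.
  have E y : S y -> ext (c \*o h) y = (c \*o ext h) y.
    by apply: extE; transitivity (c \*o res S (ext h)); [rewrite !extK|].
  apply: (calc_eq calc) => //; last exact: (acZ c hA).
  by apply: eq_ac (acZ c hA) _ => y /E.
- move=> h k /ext_ac hA /ext_ac kA x; rewrite -[RHS](calcM calc)//.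
  have E y : S y -> ext (h \* k) y = (ext h \* ext k) y.
    by apply: extE; transitivity (res S (ext h) \* res S (ext k)); [rewrite !extK|].
  apply: (calc_eq calc) => //; last exact: acM hA kA.
  by apply: eq_ac (acM hA kA) _ => y /E.
- move=> x; rewrite -[RHS](calc1 calc); apply: (calc_eq calc).
  + by apply: ext_ac; have [] := ac1 S.
  + exact: ac1.
  + by move=> y; apply: extE.
Qed.

(** Restricting functions from [S] to a subset [S'] does not increase norms. *)
Lemma calculus_superset S S' a b T Psi K : bounded_in S a b -> S' `<=` S ->
  calculus S' T Psi K -> calculus S T Psi K.
Proof.
move=> Sab S'S calc; have acS f : ac S f -> ac S' f by exact: ac_subset Sab S'S.
split.
- exact: calc_ge0 calc.
- by move=> f g x /acS fA /acS gA; exact: (calcD calc).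
- by move=> c f x /acS fA; exact: (calcZ calc).
- by move=> f g x /acS fA /acS gA; exact: (calcM calc).
- exact: calc1 calc.
- exact: calc_id calc.
- move=> f M /acS fA fM x; apply: (calc_bound calc) => //.
  exact: bv_le_subset fM.
Qed.

(** The resolvent of [T] at [z] is the calculus applied to [1 / (z - x)]. *)
Lemma spectrum_subset a b T Psi K : calculus (seg a b) T Psi K ->
  spectrum T `<=` reals (seg a b).
Proof.
move=> calc z zT; apply: contrapT => zS; apply: zT.
have rA := ac_resolvent zS; set r := fun _ => _ in rA.
have kA := acB (ac_cst (seg a b) z) (ac_id _).
have kT x : Psi (cst z \- id_C) x = z *: x - T x.
  rewrite (calcB calc) ?(calc_id calc)//; [|exact: ac_cst|exact: ac_id].
  have -> : cst z = z \*o cst 1 :> (R -> R[i]).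
    by apply/funext => y /=; rewrite mulr1.
  by rewrite (calcZ calc) ?(calc1 calc)//; exact: ac1.
have rk y : seg a b y -> r y * (z - y%:C) = 1.
  move=> Sy; rewrite mulVf// subr_eq0; apply/eqP => zy; apply: zS.
  by exists y.
exists (Psi r); split.
- exact: calc_continuous (@seg_bounded _ a b) calc _ rA.
- move=> x; rewrite -kT -(calcM calc)// -[RHS](calc1 calc).
  by apply: (calc_eq calc) => //; [exact: acM|exact: ac1].
- move=> x; rewrite -kT -(calcM calc)// -[RHS](calc1 calc).
  apply: (calc_eq calc) => //; [exact: acM|exact: ac1|].
  by move=> y Sy /=; rewrite mulrC rk.
Qed.

End Calculus.

(** * Points at which a calculus vanishes *)

Section NullPoints.
Variables (R : realType) (X : completeNormedModType R[i]).
Variables (a b : R) (T : {linear X -> X}).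
Variables (Psi : (R -> R[i]) -> {linear X -> X}) (K : R).
Hypothesis calc : calculus (seg a b) T Psi K.
Implicit Types (f g : R -> R[i]) (c d e w x L : R) (u : X).

Local Notation J := (seg a b).
Let Jab : bounded_in J a b := @seg_bounded R a b.

(** The points off the support of [Psi], seen as a distribution. *)
Definition null_at w := exists2 e, 0 < e & forall g, ac J g ->
  (forall x, J x -> e <= `|x - w| -> g x = 0) -> forall u, Psi g u = 0.

Lemma null_near w : null_at w -> exists2 e, 0 < e &
  forall w', `|w' - w| < e -> null_at w'.
Proof.
move=> [e e0 eP]; exists (e / 2); first by rewrite divr_gt0.
move=> w' ww'; exists (e / 2); first by rewrite divr_gt0.
move=> g gA g0; apply: eP => // x Jx xw; apply: g0 => //.
have := ler_distD w' x w; lra.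
Qed.

Lemma bv_le_clamp_diff (S : set R) w e : 0 <= e ->
  bv_le S (cst w%:C \- (id_C \o clamp (w - e) (w + e))) (3 * e).
Proof.
move=> e0; have we : w - e <= w + e by lra.
have := @bv_le_nonincreasing _ S (fun x => w - clamp (w - e) (w + e) x) (- e) e e.
have -> : e + (e - - e) = 3 * e by ring.
move=> /(_ ltac:(lra) e0) H.
apply: eq_bv_le (H _ _ _) _ => [x _|x _|x y _ _ xy|x _].
- by have := clamp_itv x we; rewrite ler_norml; lra.
- by have := clamp_itv x we; lra.
- by rewrite lerD2l lerN2 clamp_mono.
- by rewrite /= rmorphB.
Qed.

(** Let [S] invert [w - T] with norm [M], and let [g] vanish off a ball of
radius [e] around [w]. There [w - x] agrees with a function of norm [3 e], so
[Psi g = S^n (Psi ((w - x)^n g))] has norm [O((3 e M)^n)]. *)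
Lemma null_resolvent w : ~ spectrum T w%:C -> null_at w.
Proof.
move=> /contrapT[S [S_cont SL _]].
have [M M0 SM] := continuous_rbound S_cont.
(* 3 * e * M = 1 / 2 *)
pose e := (6 * M)^-1; have e0 : 0 < e by rewrite invr_gt0 mulr_gt0.
exists e => // g; have we : w - e <= w + e by lra.
pose k := cst w%:C \- (id_C \o clamp (w - e) (w + e)).
have k_ac : ac J k by apply: acB (ac_cst _ _) (ac_clamp Jab we).
have kE h : (forall x, J x -> e <= `|x - w| -> h x = 0) ->
    forall x, J x -> (k \* h) x = (w%:C - x%:C) * h x.
  move=> h0 x Jx; rewrite /k /= /id_C.
  have [xw|wx] := leP e `|x - w|; first by rewrite h0// !mulr0.
  by rewrite clamp_id//; move: wx; rewrite ltr_norml; lra.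
have iter n : forall h N, ac J h -> bv_le J h N ->
    (forall x, J x -> e <= `|x - w| -> h x = 0) ->
  forall u, rnorm (Psi h u) <= 2^-1 ^+ n * (K * N * rnorm u).
  elim: n => [|n IH] h N hA hN h0 u; first by rewrite mul1r (calc_bound calc).
  have step : Psi h u = S (Psi (k \* h) u).
    rewrite -[LHS](SL (Psi h u)); congr (S _).
    have wA : ac J (cst w%:C \- id_C) by apply: acB (ac_cst _ _) (ac_id _).
    transitivity (Psi ((cst w%:C \- id_C) \* h) u).
      rewrite (calcM calc)// (calcB calc); [|exact: ac_cst|exact: ac_id].
      rewrite (calc_id calc); congr (_ - _).
      have -> : cst w%:C = w%:C \*o cst 1 :> (R -> R[i]).
        by apply/funext => y /=; rewrite mulr1.
      by rewrite (calcZ calc) ?(calc1 calc)//; exact: ac1.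
    apply: (calc_eq calc); [exact: acM|exact: acM|move=> x Jx].
    by rewrite kE.
  have kh0 x : J x -> e <= `|x - w| -> (k \* h) x = 0.
    by move=> Jx xw; rewrite /= h0// mulr0.
  have khN := bv_leM (bv_le_clamp_diff J w (ltW e0)) hN.
  rewrite step (le_trans (SM _))//.
  apply: (@le_trans _ _ (M * (2^-1 ^+ n * (K * (3 * e * N) * rnorm u)))).
    by rewrite ler_wpM2l ?(ltW M0)//; apply: IH => //; exact: acM.
  rewrite le_eqVlt; apply/orP; left; apply/eqP; rewrite exprSr /e.
  by field; rewrite gt_eqF.
move=> gA g0 u; have [N gN] := ac_bv Jab gA.
apply: rnorm_small => d d0; set y := rnorm u.
have KN0 : 0 <= K * N * y.
  by rewrite !mulr_ge0 ?rnorm_ge0 ?(calc_ge0 calc) ?(bv_le_ge0 gN).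
have [|||n nP] := @geometric_small R 2^-1 (d / (K * N * y + 1)).
- by [].
- by rewrite invf_lt1 ?ltr1n.
- by rewrite divr_gt0// ltr_wpDl.
rewrite (le_trans (iter n g N gA gN g0 u))//.
apply: (@le_trans _ _ (2^-1 ^+ n * (K * N * y + 1))).
  by rewrite ler_wpM2l ?exprn_ge0// lerDl.
by rewrite -ler_pdivlMr// ltr_wpDl.
Qed.

Lemma null_outside w : ~ J w -> null_at w.
Proof.
move=> Jw; apply: null_resolvent => /(spectrum_subset calc)[x Jx].
by move/complexI => xw; apply: Jw; rewrite -xw.
Qed.

Definition cutoff p q x : R := (q - clamp p q x) / (q - p).

Lemma cutoff_left p q x : p < q -> x <= p -> cutoff p q x = 1.
Proof. by move=> pq xp; rewrite /cutoff clamp_left// divff// subr_eq0 gt_eqF. Qed.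

Lemma cutoff_right p q x : p < q -> q <= x -> cutoff p q x = 0.
Proof. by move=> pq qx; rewrite /cutoff (clamp_right (ltW pq) qx) subrr mul0r. Qed.

Lemma ac_cutoff p q : p < q -> ac J (fun x => (cutoff p q x)%:C).
Proof.
move=> pq; have := acZ (q - p)^-1%:C (acB (ac_cst J q%:C) (ac_clamp Jab (ltW pq))).
move=> cA; apply: eq_ac cA _ => x _ /=.
by rewrite /cutoff /id_C -rmorphB -rmorphM mulrC.
Qed.

Lemma bv_le_cutoff (S : set R) p q : p < q ->
  bv_le S (fun x => (cutoff p q x)%:C) 2.
Proof.
move=> pq; have qp0 : 0 < q - p by rewrite subr_gt0.
have c01 x : 0 <= cutoff p q x <= 1.
  have := clamp_itv x (ltW pq); rewrite /cutoff ler_pdivrMr// => pxq.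
  by rewrite divr_ge0//=; lra.
have -> : 2 = 1 + (1 - 0) :> R by ring.
apply: bv_le_nonincreasing => // [x _|x y _ _ xy].
  by rewrite ger0_norm; have := c01 x; lra.
by rewrite ler_pM2r ?invr_gt0// lerD2l lerN2 clamp_mono.
Qed.

(** The set of the [m] for which functions supported in [[c, m]] are killed
reaches [d]: at its supremum [s], a cutoff splits such a function into one
supported in [[c, m]] with [m <= s] and one supported near the null point
[s]. *)
Lemma calc_null_segment c d g : c <= d ->
    (forall w, c <= w <= d -> null_at w) -> ac J g ->
    (forall x, J x -> ~ (c <= x <= d) -> g x = 0) ->
  forall u, Psi g u = 0.
Proof.
move=> cd null_cd gA g0.
pose E m := forall h, ac J h -> (forall x, J x -> ~ (c <= x <= m) -> h x = 0) ->
  forall u, Psi h u = 0.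
pose A := [set m | c <= m <= d /\ E m].
suff Ed : E d by exact: Ed.
have Ac : A c.
  split; first by rewrite lexx.
  have [e e0 eP] := null_cd c ltac:(by rewrite lexx).
  move=> h hA h0; apply: eP => // x Jx ex; apply: h0 => // /le_anti xc.
  by move: ex; rewrite xc subrr normr0 leNgt e0.
have supA : has_sup A by split; [exists c|exists d => m [/andP[]]].
pose s := sup A.
have cs : c <= s by exact: sup_upper_bound.
have sd : s <= d by apply: ge_sup; [exists c|move=> m [/andP[]]].
have [e e0 eP] := null_cd s ltac:(by rewrite cs).
have [m [/andP[cm md] Em]] := sup_adherent e0 supA; rewrite -/s => sem.
have ms : m <= s by apply: sup_upper_bound => //; split => //; exact/andP.
pose m' := Num.min d (s + e / 2).
have m'e : m' <= s + e / 2 by rewrite ge_min lexx orbT.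
have Em' : E m'.
  move=> h hA h0 u; pose k x := (cutoff (s - e) m x)%:C.
  have kA : ac J k := ac_cutoff sem.
  have k'A := acB (ac_cst J 1) kA.
  have <- : Psi (k \* h) u + Psi ((cst 1 \- k) \* h) u = Psi h u.
    rewrite -(calcD calc); [|exact: acM|exact: acM].
    apply: (calc_eq calc) => // [|x _]; first by apply: acD; exact: acM.
    by rewrite /=; ring.
  have k0 : Psi (k \* h) u = 0.
    apply: Em => [|x Jx xm]; first exact: acM.
    have [mx|xltm] := leP m x; first by rewrite /= /k cutoff_right// mul0r.
    rewrite /= h0 ?mulr0// => /andP[cx _]; apply: xm.
    by rewrite cx ltW.
  rewrite k0 add0r; apply: eP => [|x Jx xs]; first exact: acM.
  have [xs'|sx] := leP x s.
    rewrite /= /k cutoff_left ?subrr ?mul0r//.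
    by move: xs; rewrite ler0_norm ?subr_le0//; lra.
  rewrite /= h0 ?mulr0// => /andP[_ xm'].
  by move: xs; rewrite gtr0_norm ?subr_gt0//; lra.
have cm' : c <= m' by rewrite le_min cd/=; lra.
have : m' <= s.
  by apply: sup_upper_bound => //; split => //; rewrite cm' ge_min lexx.
have [dm|me] := leP d (s + e / 2).
  by have <- : m' = d by rewrite /m' min_l.
by have -> : m' = s + e / 2; [rewrite /m' min_r// ltW|lra].
Qed.

Lemma lipschitz_bv_le_clamp (S : set R) g L p q : 0 <= L -> p <= q ->
    (forall x y, rnorm (g x - g y) <= L * `|x - y|) -> g p = 0 \/ g q = 0 ->
  bv_le S (g \o clamp p q) (2 * L * (q - p)).
Proof.
move=> L0 pq gL gpq; have qp0 : 0 <= q - p by rewrite subr_ge0.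
apply: (@bv_le_comp _ (seg p q)) => [x _|x y _ _|].
- exact: clamp_itv.
- exact: clamp_mono.
- have -> : 2 * L * (q - p) = L * (q - p) + L * (q - p) by ring.
  apply: bv_le_lipschitz => // [|x /andP[px xq]|x y _ _ xy].
  + by rewrite mulr_ge0.
  + have [gp|gq] := gpq.
      rewrite -[g x]subr0 -gp (le_trans (gL _ _))// ler_wpM2l//.
      by rewrite ger0_norm; lra.
    rewrite -[g x]subr0 -gq (le_trans (gL _ _))// ler_wpM2l//.
    by rewrite ler0_norm; lra.
  + by rewrite (le_trans (gL _ _))// ger0_norm// subr_ge0.
Qed.

(** Near a zero [c] of a Lipschitz function [g], [g] is small in norm; so
cutting [g] off to the left of [c + h] is a small perturbation. *)
Lemma trim_left c g h L : 0 < h -> 0 <= L ->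
    (forall x y, rnorm (g x - g y) <= L * `|x - y|) ->
    (forall x, J x -> x <= c -> g x = 0) -> g c = 0 ->
  exists k, [/\ ac J k, bv_le J k 3, bv_le J (g \- (k \* g)) (8 * L * h) &
    forall x, J x -> x <= c + h -> k x = 0].
Proof.
move=> h0 L0 gL g0 gc0; have hh : c + h < c + h + h by lra.
pose k x := (cutoff (c + h) (c + h + h) x)%:C.
exists (cst 1 \- k); split.
- by apply: acB (ac_cutoff hh); exact: ac_cst.
- have -> : 3 = rnorm (1 : R[i]) + 2 :> R by rewrite rnorm1; ring.
  exact: bv_leB (bv_le_cst J 1) (bv_le_cutoff J hh).
- have -> : 8 * L * h = 2 * L * (c + h + h - c) * 2 by ring.
  have chh : c <= c + h + h by lra.
  apply: eq_bv_le (bv_leM (lipschitz_bv_le_clamp J L0 chh gL (or_introl gc0))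
    (bv_le_cutoff J hh)) _ => x Jx /=.
  rewrite -/(k x); case: (clampP x chh) => [xc|_ _|xh]; last 2 first.
  + by ring.
  + by rewrite /k cutoff_right//; ring.
  + by rewrite gc0 g0//; ring.
- by move=> x _ xc /=; rewrite /k cutoff_left// subrr.
Qed.

Lemma trim_right d g h L : 0 < h -> 0 <= L ->
    (forall x y, rnorm (g x - g y) <= L * `|x - y|) ->
    (forall x, J x -> d <= x -> g x = 0) -> g d = 0 ->
  exists k, [/\ ac J k, bv_le J k 3, bv_le J (g \- (k \* g)) (8 * L * h) &
    forall x, J x -> d - h <= x -> k x = 0].
Proof.
move=> h0 L0 gL g0 gd0; have hh : d - h - h < d - h by lra.
pose k x := (cutoff (d - h - h) (d - h) x)%:C.
have kA : ac J k := ac_cutoff hh.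
exists k; split => //.
- by apply: bv_le_trans (bv_le_cutoff J hh); lra.
- have k'_bv : bv_le J (cst 1 \- k) 2.
    apply: (@eq_bv_le _ _ (fun x => (1 - cutoff (d - h - h) (d - h) x)%:C)).
      have hh0 : 0 < d - h - (d - h - h) by lra.
      have c01 x : 0 <= 1 - cutoff (d - h - h) (d - h) x <= 1.
        have := clamp_itv x (ltW hh); rewrite /cutoff => pxq.
        rewrite subr_ge0 ler_pdivrMr// mul1r gerBl divr_ge0 ?(ltW hh0)//; lra.
      have -> : 2 = 1 + (1 - 0) :> R by ring.
      apply: (@bv_le_nondecreasing _ _
        (fun x => 1 - cutoff (d - h - h) (d - h) x)) => // [x _|x y _ _ xy].
        by rewrite ger0_norm; have := c01 x; lra.
      by rewrite lerD2l lerN2 ler_pM2r ?invr_gt0// lerD2l lerN2 clamp_mono.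
    by move=> x _ /=; rewrite rmorphB.
  have -> : 8 * L * h = 2 * L * (d - (d - h - h)) * 2 by ring.
  have dhh : d - h - h <= d by lra.
  apply: eq_bv_le (bv_leM (lipschitz_bv_le_clamp J L0 dhh gL (or_intror gd0))
    k'_bv) _ => x Jx /=.
  case: (clampP x dhh) => [xh|_ _|dx].
  + by rewrite /k cutoff_left//; ring.
  + by ring.
  + by rewrite gd0 g0//; ring.
- by move=> x _ dx; rewrite /k cutoff_right.
Qed.

(** The null interval is open, so [calc_null_segment] does not apply to it. At an
end that is not null, [g] vanishes there and is Lipschitz; cutting it off near
that end is a perturbation of size [O(h)]. *)
Lemma calc_null_gap c d g : c < d -> is_lipschitz g -> ac J g ->
    (forall w, c < w < d -> null_at w) ->
    null_at c \/ g c = 0 -> null_at d \/ g d = 0 ->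
    (forall x, J x -> ~ (c < x < d) -> g x = 0) ->
  forall u, Psi g u = 0.
Proof.
move=> cd [L L0 gL] gA null_cd null_c null_d g0 u.
apply: rnorm_small => e e0; set y := rnorm u.
have y0 : 0 <= y := rnorm_ge0 u; have K0 := calc_ge0 calc.
have Q0 : 0 <= K * (32 * L) * y by rewrite !mulr_ge0.
(* the two trimmings cost at most 32 * L * h in norm *)
pose h := Num.min ((d - c) / 3) (e / (K * (32 * L) * y + 1)).
have h0 : 0 < h by rewrite lt_min !divr_gt0 ?subr_gt0// ltr_wpDl.
have h3 : h <= (d - c) / 3 by rewrite ge_min lexx.
have he : K * (32 * L * h) * y <= e.
  apply: (@le_trans _ _ (h * (K * (32 * L) * y + 1))).
    by rewrite mulrDr mulr1; lra.
  by rewrite -ler_pdivlMr ?ltr_wpDl// ge_min lexx orbT.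
have one_bv : bv_le J (cst 1) 3.
  by apply: bv_le_trans (bv_le_cst _ _); rewrite rnorm1; lra.
have zero_bv : bv_le J (g \- (cst 1 \* g)) (8 * L * h).
  apply: (@bv_le_trans _ _ _ (rnorm (0 : R[i]))).
    by rewrite rnorm0 !mulr_ge0// ltW.
  by apply: eq_bv_le (bv_le_cst _ _) _ => x _ /=; rewrite mul1r subrr.
have [k [c' [cc' c'h null_c' [kA k_bv gk kc']]]] :
    exists k c', [/\ c <= c', c' <= c + h, forall w, c' <= w < d -> null_at w &
      [/\ ac J k, bv_le J k 3, bv_le J (g \- (k \* g)) (8 * L * h) &
       forall x, J x -> x < c' -> (k \* g) x = 0]].
  have [nc|gc0] := null_c.
    exists (cst 1), c; split; [exact: lexx|lra| |split => //].
    + move=> w /andP[cw wd]; have [<-//|wc] := eqVneq c w.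
      by apply: null_cd; rewrite lt_neqAle wc cw.
    + exact: ac_cst.
    + by move=> x Jx xc; rewrite /= g0 ?mulr0//; lra.
  have [|k [kA k_bv gk k0]] := trim_left h0 L0 gL _ gc0.
    by move=> x Jx xc; apply: g0 => //; lra.
  exists k, (c + h); split; [lra|lra| |split => //].
  + by move=> w wd; apply: null_cd; lra.
  + by move=> x Jx xc; rewrite /= k0 ?mul0r// ltW.
have [l [d' [dd' d'h null_d' [lA l_bv gl ld']]]] :
    exists l d', [/\ d' <= d, d - h <= d', forall w, c' <= w <= d' -> null_at w &
      [/\ ac J l, bv_le J l 3, bv_le J (g \- (l \* g)) (8 * L * h) &
       forall x, J x -> d' < x -> (l \* g) x = 0]].
  have [nd|gd0] := null_d.
    exists (cst 1), d; split; [exact: lexx|lra| |split => //].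
    + move=> w /andP[cw wd]; have [->//|wd'] := eqVneq w d.
      by apply: null_c'; rewrite cw lt_neqAle wd' wd.
    + exact: ac_cst.
    + by move=> x Jx xd; rewrite /= g0 ?mulr0//; lra.
  have [|l [lA l_bv gl l0]] := trim_right h0 L0 gL _ gd0.
    by move=> x Jx xc; apply: g0 => //; lra.
  exists l, (d - h); split; [lra|lra| |split => //].
  + by move=> w wd; apply: null_c'; lra.
  + by move=> x Jx xd; rewrite /= l0 ?mul0r// ltW.
have lkg0 : Psi (l \* (k \* g)) u = 0.
  apply: (@calc_null_segment c' d') => //; [lra|by do 2![apply: acM => //]|].
  move=> x Jx xcd; have [xc|cx] := ltP x c'; first by rewrite /= -/((k \* g) x) kc'// mulr0.
  have [dx|xd] := ltP d' x; last by exfalso; apply: xcd; rewrite cx.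
  by rewrite /= mulrCA -/((l \* g) x) ld'// mulr0.
have lkgA : ac J (l \* (k \* g)) by do 2![apply: acM => //].
have -> : Psi g u = Psi (g \- (l \* (k \* g))) u.
  by rewrite (calcB calc)// lkg0 subr0.
rewrite (le_trans _ he)//; apply: (calc_bound calc); first exact: acB.
(* g - l k g = (g - k g) + k (g - l g) *)
have -> : 32 * L * h = 8 * L * h + 3 * (8 * L * h) by ring.
by apply: eq_bv_le (bv_leD gk (bv_leM k_bv gl)) _ => x _ /=; ring.
Qed.

End NullPoints.

(** * Interpolation across one gap *)

Section Gaps.
Variables (R : realType) (X : completeNormedModType R[i]).
Implicit Types (S A B : set R) (f F : R -> R[i]) (w : R -> R).

(** Affine interpolation across a gap of [A] costs no variation: extend the
dominating function [w] affinely as well. *)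
Lemma bv_le_interpolate A F w (c d c0 v wc wd : R) (fc fd : R[i]) :
    c < d -> 0 <= c0 -> 0 <= v ->
    (forall x, A x -> ~ (c < x < d) -> rnorm (F x) <= c0 /\ 0 <= w x <= v) ->
    (forall x y, A x -> A y -> ~ (c < x < d) -> ~ (c < y < d) -> x <= y ->
      rnorm (F y - F x) <= w y - w x) ->
    rnorm fc <= c0 -> rnorm fd <= c0 -> 0 <= wc -> wd <= v ->
    rnorm (fd - fc) <= wd - wc ->
    (forall x, A x -> x <= c -> rnorm (fc - F x) <= wc - w x) ->
    (forall x, A x -> d <= x -> rnorm (F x - fd) <= w x - wd) ->
    (forall x, A x -> c < x < d ->
      F x = fc + ((x - c) / (d - c))%:C * (fd - fc)) ->
  bv_le A F (c0 + v).
Proof.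
move=> cd c00 v0 Fout Fw fcb fdb wc0 wdv fcd Fc Fd Fin.
have dc0 : 0 < d - c by rewrite subr_gt0.
have wcd : wc <= wd by rewrite -subr_ge0 (le_trans (rnorm_ge0 _) fcd).
pose s x := (x - c) / (d - c).
have s01 x : c < x < d -> 0 <= s x <= 1.
  move=> xcd; rewrite /s ler_pdivrMr// mul1r divr_ge0 ?(ltW dc0)//=; lra.
have s_mono x y : x <= y -> s x <= s y.
  by move=> xy; rewrite /s ler_pM2r ?invr_gt0// lerD2r.
exists c0, v; split => // [x Ax|].
  have [xcd|xcd] := pselect (c < x < d); last by have [] := Fout x Ax xcd.
  rewrite Fin// -/(s x); have := s01 x xcd; set r := s x => r01.
  have -> : fc + r%:C * (fd - fc) = (1 - r)%:C * fc + r%:C * fd.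
    by rewrite rmorphB; ring.
  rewrite (le_trans (rnormD _ _))// !rnormM !rnormC !ger0_norm; [|lra..].
  have -> : c0 = (1 - r) * c0 + r * c0 by ring.
  by rewrite lerD// ler_wpM2l//; lra.
pose w' x := if c < x < d then wc + s x * (wd - wc) else w x.
have w'in x : c < x < d -> w' x = wc + s x * (wd - wc) by rewrite /w' => ->.
have w'out x : ~ (c < x < d) -> w' x = w x by rewrite /w' => /negP/negbTE->.
exists w'; split => [x Ax|x y Ax Ay xy].
  have [xcd|xcd] := pselect (c < x < d); last first.
    by rewrite w'out//; have [] := Fout x Ax xcd.
  rewrite w'in//; have /andP[r0 r1] := s01 x xcd; set r := s x in r0 r1 *.
  have : 0 <= r * (wd - wc) by rewrite mulr_ge0// subr_ge0.
  have : r * (wd - wc) <= 1 * (wd - wc) by rewrite ler_wpM2r// subr_ge0.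
  lra.
have [xcd|xcd] := pselect (c < x < d); have [ycd|ycd] := pselect (c < y < d).
- rewrite !w'in// !Fin// -/(s x) -/(s y).
  have -> : fc + (s y)%:C * (fd - fc) - (fc + (s x)%:C * (fd - fc)) =
      (s y - s x)%:C * (fd - fc) by rewrite rmorphB; ring.
  have -> : wc + s y * (wd - wc) - (wc + s x * (wd - wc)) =
    (s y - s x) * (wd - wc) by ring.
  have sxy : 0 <= s y - s x by rewrite subr_ge0 s_mono.
  by rewrite rnormM rnormC ger0_norm// ler_wpM2l.
- have dy : d <= y by rewrite leNgt; apply/negP => yd; apply: ycd; lra.
  rewrite (w'in x xcd) (w'out y ycd) (Fin x Ax xcd) -/(s x).
  have /andP[r0 r1] := s01 x xcd; set r := s x in r0 r1 *.
  have -> : F y - (fc + r%:C * (fd - fc)) =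
      (F y - fd) + (1 - r)%:C * (fd - fc) by rewrite rmorphB; ring.
  have -> : w y - (wc + r * (wd - wc)) = (w y - wd) + (1 - r) * (wd - wc) by ring.
  rewrite (le_trans (rnormD _ _))// rnormM rnormC ger0_norm ?subr_ge0//.
  by rewrite lerD ?Fd// ler_wpM2l ?subr_ge0.
- have xc : x <= c by rewrite leNgt; apply/negP => cx; apply: xcd; lra.
  rewrite (w'in y ycd) (w'out x xcd) (Fin y Ay ycd) -/(s y).
  have /andP[r0 r1] := s01 y ycd; set r := s y in r0 r1 *.
  have -> : fc + r%:C * (fd - fc) - F x = (fc - F x) + r%:C * (fd - fc) by ring.
  have -> : wc + r * (wd - wc) - w x = (wc - w x) + r * (wd - wc) by ring.
  rewrite (le_trans (rnormD _ _))// rnormM rnormC ger0_norm//.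
  by rewrite lerD ?Fc// ler_wpM2l.
- by rewrite !w'out// Fw.
Qed.

Variables (a b : R) (T : {linear X -> X}).
Variables (Psi : (R -> R[i]) -> {linear X -> X}) (K : R).
Hypothesis calc : calculus (seg a b) T Psi K.

Local Notation J := (seg a b).
Local Notation null := (null_at a b Psi).
Let Jab : bounded_in J a b := @seg_bounded R a b.

(** The estimate to be carried from [J], where it holds by definition, down to
the support of [Psi]. *)
Definition controls A := forall F M, is_lipschitz F -> ac J F -> bv_le A F M ->
  forall u, rnorm (Psi F u) <= K * M * rnorm u.

Lemma controls_subset A B : A `<=` B -> controls A -> controls B.
Proof.
move=> AB Actrl F M FL FA FM; apply: Actrl => //; exact: bv_le_subset FM.
Qed.

(** Replacing [F] between [c] and [d] by its affine interpolation changes it by a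
function that vanishes off the gap, hence does not change [Psi F], and makes
its norm on [A] at most that off the gap. An end beyond the segment
carries no constraint; there the interpolation is constant. *)
Lemma controls_gap A (c d : R) : A `<=` J -> c < d -> c <= b -> a <= d ->
    (forall x, c < x < d -> null x) -> A c \/ c < a -> A d \/ b < d ->
  controls A -> controls (A `&` [set x | ~ (c < x < d)]).
Proof.
move=> AJ cd cb ad null_cd Ac Ad Actrl F M [L L0 FL] FA.
move=> [c0 [v [c00 v0 cvM Fc0 [w [wv Fw]]]]] u.
have ncc : ~ (c < c < d) by lra.
have ndd : ~ (c < d < d) by lra.
have finish (fc fd : R[i]) (wc wd : R) : F c = fc \/ c < a -> F d = fd \/ b < d ->
    rnorm fc <= c0 -> rnorm fd <= c0 -> 0 <= wc -> wd <= v ->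
    rnorm (fd - fc) <= wd - wc ->
    (forall x, A x -> x <= c -> rnorm (fc - F x) <= wc - w x) ->
    (forall x, A x -> d <= x -> rnorm (F x - fd) <= w x - wd) ->
    rnorm (Psi F u) <= K * M * rnorm u.
  move=> Fcfc Fdfd fcb fdb wc0 wdv fcd Fc Fd.
  have dc0 : 0 < d - c by rewrite subr_gt0.
  pose t : R[i] := ((d - c)^-1)%:C * (fd - fc).
  pose l x : R[i] := fc + (x - c)%:C * t.
  pose g := (F \o clamp c d) \- (l \o clamp c d).
  have lc : l c = fc by rewrite /l subrr mul0r addr0.
  have ld : l d = fd.
    by rewrite /l /t mulrA -rmorphM mulfV ?gt_eqF// mul1r addrC subrK.
  have gA : ac J g.
    apply: acB; first exact: ac_comp_clamp (ltW cd) cb ad FA.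
    apply: eq_ac (acD (ac_cst _ fc)
      (acM (acB (ac_clamp Jab (ltW cd)) (ac_cst _ c%:C)) (ac_cst _ t))) _ => x _ /=.
    by rewrite /l rmorphB.
  have gL : is_lipschitz g.
    exists (L + rnorm t) => [|x y]; first by rewrite addr_ge0// rnorm_ge0.
    have -> : g x - g y = (F (clamp c d x) - F (clamp c d y)) -
        (clamp c d x - clamp c d y)%:C * t.
      by rewrite /g /l /= !rmorphB; ring.
    have cl := clamp_lip x y (ltW cd).
    rewrite (le_trans (rnormB _ _))// mulrDl lerD//.
      by rewrite (le_trans (FL _ _))// ler_wpM2l.
    by rewrite rnormM rnormC mulrC ler_wpM2l ?rnorm_ge0.
  have gleft x : x <= c -> g x = F c - fc.
    by move=> xc; rewrite /g /= clamp_left// lc.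
  have gright x : d <= x -> g x = F d - fd.
    by move=> dx; rewrite /g /= (clamp_right (ltW cd) dx) ld.
  have g0 x : J x -> ~ (c < x < d) -> g x = 0.
    move=> /andP[ax xb] xcd; have [xc|cx] := leP x c.
      by rewrite gleft//; case: Fcfc => [->|ca]; [rewrite subrr|exfalso; lra].
    have [dx|xd] := leP d x; last by exfalso; apply: xcd; rewrite cx.
    by rewrite gright//; case: Fdfd => [->|bd]; [rewrite subrr|exfalso; lra].
  have Psig : Psi g u = 0.
    apply: (calc_null_gap calc cd gL gA null_cd) => //.
      rewrite gleft//; case: Fcfc => [->|ca]; [by right; rewrite subrr|left].
      by apply: (null_outside calc) => /andP[]; lra.
    rewrite gright//; case: Fdfd => [->|bd]; [by right; rewrite subrr|left].
    by apply: (null_outside calc) => /andP[]; lra.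
  have -> : Psi F u = Psi (F \- g) u by rewrite (calcB calc)// Psig subr0.
  have FgE x : A x -> ~ (c < x < d) -> (F \- g) x = F x.
    by move=> Ax xcd; rewrite /= g0 ?subr0//; exact: AJ.
  have cM : bv_le A (F \- g) (c0 + v).
    apply: (@bv_le_interpolate A _ w c d c0 v wc wd fc fd) => //.
    - by move=> x Ax xcd; rewrite FgE//; split; [exact: Fc0|exact: wv].
    - by move=> x y Ax Ay xcd ycd; rewrite !FgE//; apply: Fw.
    - by move=> x Ax xc; rewrite FgE ?Fc//; lra.
    - by move=> x Ax dx; rewrite FgE ?Fd//; lra.
    - move=> x Ax xcd; rewrite /g /= clamp_id; last lra.
      by rewrite /l /t mulrA -rmorphM/=; ring.
  apply: Actrl; [|exact: acB|exact: bv_le_trans cM].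
  have [L' L'0 gL'] := gL; exists (L + L') => [|x y]; first exact: addr_ge0.
  have -> : (F \- g) x - (F \- g) y = (F x - F y) - (g x - g y) by rewrite /=; ring.
  by rewrite (le_trans (rnormB _ _))// mulrDl lerD.
have [Ac'|ca] := Ac; have [Ad'|bd] := Ad.
- have Bc : (A `&` [set x | ~ (c < x < d)]) c by [].
  have Bd : (A `&` [set x | ~ (c < x < d)]) d by [].
  apply: (finish (F c) (F d) (w c) (w d)); [by left|by left|exact: Fc0|exact: Fc0
    |by have /andP[] := wv c Bc|by have /andP[] := wv d Bd|by apply: Fw => //; lra
    | |].
  + by move=> x Ax xc; apply: Fw => //; split => //=; lra.
  + by move=> x Ax dx; apply: Fw => //; split => //=; lra.
- have Bc : (A `&` [set x | ~ (c < x < d)]) c by [].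
  have /andP[wc0 wcv] := wv c Bc.
  apply: (finish (F c) (F c) (w c) (w c)) => //; [by left|by right|exact: Fc0|exact: Fc0| | |].
  + by rewrite !subrr rnorm0.
  + by move=> x Ax xc; apply: Fw => //; split => //=; lra.
  + by move=> x /AJ/andP[_ xb]; lra.
- have Bd : (A `&` [set x | ~ (c < x < d)]) d by [].
  have /andP[wd0 wdv] := wv d Bd.
  apply: (finish (F d) (F d) (w d) (w d)) => //; [by right|by left|exact: Fc0|exact: Fc0| | |].
  + by rewrite !subrr rnorm0.
  + by move=> x /AJ/andP[ax _]; lra.
  + by move=> x Ax xc; apply: Fw => //; split => //=; lra.
- apply: (finish 0 0 0 0) => //; rewrite ?subrr ?rnorm0//; [by right|by right| |].
  + by move=> x /AJ/andP[ax _]; lra.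
  + by move=> x /AJ/andP[_ xb]; lra.
Qed.

End Gaps.

(** * Removing all gaps *)

Section MeasureFunction.
Variable R : realType.
Implicit Types (U : set R) (e x y z : R).

Local Notation mu := (@lebesgue_measure R).

(** The distribution function of Lebesgue measure on [U] measures how much of an
interval lies in [U]. *)
Lemma measure_distribution U e : measurable U -> (mu U <= e%:E)%E ->
  exists m : R -> R, [/\ forall x, 0 <= m x <= e,
    forall x y, x <= y -> m x <= m y &
    forall x y, x <= y -> (forall z, x < z < y -> U z) -> y - x <= m y - m x].
Proof.
move=> mU Ue.
have mu_le (A B : set R) : measurable A -> measurable B -> A `<=` B -> (mu A <= mu B)%E.
  by move=> mA mB AB; apply: le_measure => //; rewrite inE.
have mD x : measurable (U `&` `]-oo, x]) by apply: measurableI.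
have DU x : (mu (U `&` `]-oo, x]) <= mu U)%E.
  exact: mu_le.
have Dfin x : mu (U `&` `]-oo, x]) \is a fin_num.
  by rewrite ge0_fin_numE ?measure_ge0// (le_lt_trans (DU x))// (le_lt_trans Ue) ?ltry.
exists (fun x => fine (mu (U `&` `]-oo, x]))); split => [x|x y xy|x y xy Uxy].
- rewrite fine_ge0 ?measure_ge0//= -lee_fin fineK//.
  exact: le_trans (DU x) Ue.
- apply: fine_le => //; apply: mu_le => //.
  by apply: setIS => z /=; rewrite !in_itv/= => /le_trans; exact.
- rewrite lerBrDr -lee_fin EFinD !fineK//.
  have -> : (y - x)%:E = mu `]x, y[.
    rewrite lebesgue_measure_itv/= lte_fin; case: ltP => [_|yx]; first by rewrite EFinB.
    by have -> : y = x by [apply: le_anti; rewrite xy yx]; rewrite subrr.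
  rewrite -measureU//; last 2 first.
  - exact: mD.
  - apply/seteqP; split => // z [/=]; rewrite in_itv/= => /andP[xz _] [_].
    by rewrite in_itv/= leNgt xz.
  apply: mu_le; [exact: measurableU|exact: mD|].
  move=> z [/=|[Uz]/=]; rewrite in_itv/= => zxy.
    have /andP[xz zy] := zxy; split; first exact: Uxy.
    by rewrite /= in_itv/= ltW.
  by split => //; rewrite /= in_itv/= (le_trans zxy).
Qed.

End MeasureFunction.

Section Exhaustion.
Variables (R : realType) (X : completeNormedModType R[i]).
Variables (a b : R) (T : {linear X -> X}).
Variables (Psi : (R -> R[i]) -> {linear X -> X}) (K : R).
Hypothesis calc : calculus (seg a b) T Psi K.
Hypothesis ab : a <= b.
Implicit Types (q x y z s c d e : R) (F : R -> R[i]).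

Local Notation J := (seg a b).
Local Notation null := (null_at a b Psi).
Local Notation mu := (@lebesgue_measure R).

Definition calc_support : set R := [set s | ~ null s].
Local Notation Sigma := calc_support.

Lemma calc_support_seg s : Sigma s -> J s.
Proof. by move=> Ss; apply: contrapT => /(null_outside calc). Qed.

Lemma nearest_left x : (exists2 s, Sigma s & s <= x) ->
  exists c, [/\ Sigma c, c <= x & forall s, Sigma s -> s <= x -> s <= c].
Proof.
move=> [s0 Ss0 s0x]; pose A := [set s | Sigma s /\ s <= x].
have supA : has_sup A by split; [exists s0|exists x => s []].
exists (sup A); split.
- move=> /null_near[e e0 eP]; have [s [Ss sx] es] := sup_adherent e0 supA.
  have ss : s <= sup A by exact: sup_upper_bound.
  by apply: Ss; apply: eP; rewrite ltr_norml; lra.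
- by apply: ge_sup; [exists s0|move=> s []].
- by move=> s Ss sx; exact: sup_upper_bound.
Qed.

Lemma nearest_right x : (exists2 s, Sigma s & x <= s) ->
  exists d, [/\ Sigma d, x <= d & forall s, Sigma s -> x <= s -> d <= s].
Proof.
move=> [s0 Ss0 s0x]; pose A := [set s | Sigma s /\ x <= s].
have infA : has_inf A by split; [exists s0|exists x => s []].
exists (inf A); split.
- move=> /null_near[e e0 eP]; have [s [Ss sx] es] := inf_adherent e0 infA.
  have ss : inf A <= s by apply: ge_inf => //; have [] := infA.
  by apply: Ss; apply: eP; rewrite ltr_norml; lra.
- by apply: lb_le_inf; [exists s0|move=> s []].
- by move=> s Ss sx; apply: ge_inf => //; have [] := infA.
Qed.

(** The connected component of [q] in the complement of the support, empty if
[q] is in the support. *)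
Definition gap q : set R :=
  [set x | forall s, Sigma s -> ~ (x <= s <= q) /\ ~ (q <= s <= x)].

Definition rational (k : nat) : R := if unpickle k is Some r then ratr r else 0.

(** Every gap contains a rational, so removing the gaps one rational at a time
removes all of them in the limit. *)
Definition exhaust (n : nat) : set R :=
  [set x | J x /\ forall k, (k < n)%N -> ~ gap (rational k) x].

Lemma exhaust_seg n : exhaust n `<=` J.
Proof. by move=> x []. Qed.

Lemma support_exhaust n : Sigma `<=` exhaust n.
Proof.
move=> s Ss; split; first exact: calc_support_seg.
move=> k _ /(_ s Ss)[]; set q := rational k.
by have [sq|qs] := leP s q; [move=> + _|move=> _]; apply; rewrite lexx ?sq// ltW.
Qed.

Lemma exhaust_support x : (forall n, exhaust n x) -> Sigma x.
Proof.
move=> xP /null_near[e e0 eP].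
have xe : x < x + e by rewrite ltrDl.
have [r] := rat_in_itvoo xe; rewrite in_itv/= => /andP[xr rx].
have [_ /(_ (pickle r) (ltnSn _))] := xP (pickle r).+1; apply => s Ss.
rewrite /rational pickleK; split => [/andP[xs sr]|]; last by lra.
by apply: Ss; apply: eP; rewrite ger0_norm ?subr_ge0//; lra.
Qed.

Lemma exhaustS n : exhaust n.+1 = exhaust n `\` gap (rational n).
Proof.
apply/seteqP; split => [x [Jx xn]|x [[Jx xn] nx]].
  by split; [split => // k kn; apply: xn; rewrite ltnS ltnW|exact: xn].
split => // k; rewrite ltnS leq_eqVlt => /predU1P[->//|]; exact: xn.
Qed.

Lemma controls_exhaust n : controls a b Psi K (exhaust n).
Proof.
elim: n => [|n IH].
  by move=> F M _ FA FM; apply: (calc_bound calc) => //; apply: bv_le_subset FM.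
set q := rational n; have [null_q|Sq] := pselect (null q); last first.
  apply: controls_subset IH => x xn; rewrite exhaustS; split => // /(_ q Sq)[].
  by have [xq|qx] := leP x q; [move=> + _|move=> _]; apply; rewrite lexx ?xq// ltW.
have neq s : Sigma s -> s <> q by move=> Ss sq; apply: Ss; rewrite sq.
have [c [cq cb Ac cmax]] : exists c, [/\ c < q, c <= b, Sigma c \/ c < a &
    forall s, Sigma s -> s <= q -> s <= c].
  have [/nearest_left[c [Sc cq cmax]]|no_s] := pselect (exists2 s, Sigma s & s <= q).
    exists c; split => //; [|by have /andP[] := calc_support_seg Sc|by left].
    by rewrite lt_neqAle cq andbT; apply/eqP/neq.
  have [m ma mq] : exists2 m, m <= a & m <= q.
    by exists (Num.min a q); rewrite ge_min lexx ?orbT.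
  exists (m - 1).
  split; [lra|rewrite (le_trans _ ab)//; lra|right; lra|].
  by move=> s Ss sq; exfalso; apply: no_s; exists s.
have [d [qd ad Ad dmin]] : exists d, [/\ q < d, a <= d, Sigma d \/ b < d &
    forall s, Sigma s -> q <= s -> d <= s].
  have [/nearest_right[d [Sd qd dmin]]|no_s] := pselect (exists2 s, Sigma s & q <= s).
    exists d; split => //; [|by have /andP[] := calc_support_seg Sd|by left].
    by rewrite lt_neqAle qd andbT eq_sym; apply/eqP/neq.
  have [m mb mq] : exists2 m, b <= m & q <= m.
    by exists (Num.max b q); rewrite le_max lexx ?orbT.
  exists (m + 1).
  split; [lra|rewrite (le_trans ab)//; lra|right; lra|].
  by move=> s Ss sq; exfalso; apply: no_s; exists s.
have ctrl : controls a b Psi K (exhaust n `&` [set x | ~ (c < x < d)]).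
  apply: (controls_gap calc) => //; [exact: exhaust_seg|lra| | |].
  - move=> x cxd; apply: contrapT => Sx; have [xq|qx] := leP x q.
      by have := cmax x Sx xq; lra.
    by have := dmin x Sx (ltW qx); lra.
  - by case: Ac => [/support_exhaust Ac|]; [left|right].
  - by case: Ad => [/support_exhaust Ad|]; [left|right].
apply: controls_subset ctrl => x [xn /= xcd]; rewrite exhaustS; split => // gx.
have [ax xb] := andP (exhaust_seg xn).
have [xc|cx] := leP x c.
  by case: Ac => [/gx[+ _]|]; [apply; rewrite xc ltW|lra].
have [dx|xd] := leP d x; last by apply: xcd; rewrite cx.
by case: Ad => [/gx[_]|]; [apply; rewrite dx ltW|lra].
Qed.


Lemma is_interval_gap q : is_interval (gap q).
Proof.
move=> x y gx gy z /andP[xz zy] s Ss; split => /andP[].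
  move=> zs sq; have [+ _] := gx s Ss; apply; rewrite sq andbT.
  exact: le_trans xz zs.
move=> qs sz; have [_ +] := gy s Ss; apply; rewrite qs.
exact: le_trans sz zy.
Qed.

Lemma measurable_exhaust n : measurable (exhaust n).
Proof.
elim: n => [|n IH].
  have -> : exhaust 0 = `[a, b]%classic.
    apply/seteqP; split => [x [Jx _]|x]; first by rewrite /= in_itv.
    by rewrite /= in_itv => Jx; split.
  exact: measurable_itv.
rewrite exhaustS; apply: measurableD => //.
apply: measurable_realfun.is_interval_measurable; exact: is_interval_gap.
Qed.

(** These sets decrease to the empty set inside a segment, and Lebesgue measure is
continuous from above. *)
Lemma exhaust_small (e : R) : 0 < e ->
  exists2 n, measurable (exhaust n.+1 `&` null) &
    (mu (exhaust n.+1 `&` null) <= e%:E)%E.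
Proof.
move=> e0; pose U n := exhaust n `&` null.
have SE : Sigma = \bigcap_n exhaust n.
  apply/seteqP; split => [s Ss n _|x xP]; first exact: support_exhaust.
  by apply: exhaust_support => n; exact: xP.
have mU n : measurable (U n).
  have -> : U n = exhaust n `\` Sigma.
    rewrite /U setDE; congr (_ `&` _); apply/seteqP.
    split => [x nx|x nSx]; first by move=> Sx; exact: Sx nx.
    exact: contrapT nSx.
  apply: measurableD; first exact: measurable_exhaust.
  by rewrite SE; apply: bigcapT_measurable => k; exact: measurable_exhaust.
have capU : \bigcap_n U n = set0.
  apply/seteqP; split => // x xU; have [_ nx] := xU 0%N I.
  suff : Sigma x by apply.
  by apply: exhaust_support => n; have [] := xU n I.
have U0 : (mu (U 0%N) < +oo)%E.
  apply: (@le_lt_trans _ _ (mu `[a, b]%classic)).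
    apply: le_measure; rewrite ?inE//; first exact: mU.
    by move=> x [[Jx _] _]; rewrite /= in_itv.
  by rewrite lebesgue_measure_itv/=; case: ifP => _; rewrite -?EFinB ltry.
have U_le : {homo U : n m / (n <= m)%N >-> (m <= n)%O}.
  move=> n m nm; rewrite subsetEset => x [[Jx xm] nx]; split => //.
  by split => // k kn; apply: xm; exact: leq_trans nm.
have mcapU : measurable (\bigcap_n U n) by rewrite capU.
have := nonincreasing_cvg_mu U0 mU mcapU U_le; rewrite capU measure0.
move=> /(_ _ (@nbhs_open_ereal_lt R 0 (fun=> e) e0))[n _ nP].
by exists n; [exact: mU|exact/ltW/(nP n.+1)/leqnSn].
Qed.

Lemma exhaust_convex n x z : exhaust n x -> J z ->
    (forall s, Sigma s -> ~ (x <= s <= z) /\ ~ (z <= s <= x)) ->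
  exhaust n z /\ null z.
Proof.
move=> [Jx xn] Jz xz; split; last first.
  apply: contrapT => Sz; have [] := xz z Sz.
  by have [xlez|zx] := leP x z; [move=> + _|move=> _]; apply; rewrite lexx ?xlez// ltW.
split => // k kn gz; apply: (xn k kn) => s Ss.
have [gzl gzr] := gz s Ss; have [xzl xzr] := xz s Ss.
split => /andP[s1 s2].
  by have [zs|/ltW sz] := leP z s; [apply: gzl; rewrite zs|apply: xzl; rewrite s1].
by have [zs|/ltW sz] := leP z s; [apply: xzr; rewrite zs|apply: gzr; rewrite s1].
Qed.

(** The gaps left in [exhaust n.+1] have measure at most [e], which costs [L * e]
in the sup norm and [L * e] in the variation. For the latter, if [[x, y]] meets
the support, first at [d] and last at [p], the increments of [F] over [[x, d]]
and [[p, y]] are charged to the measure and the increment over [[d, p]] to the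
variation on the support. *)
Lemma bv_le_exhaust n F (L M e : R) : 0 <= L ->
    (forall x y, rnorm (F x - F y) <= L * `|x - y|) -> bv_le Sigma F M ->
    measurable (exhaust n.+1 `&` null) ->
    (mu (exhaust n.+1 `&` null) <= e%:E)%E ->
  bv_le (exhaust n.+1) F (M + 2 * L * e).
Proof.
move=> L0 FL [c0 [v [c00 v0 cvM Fc0 [w [wv Fw]]]]] mU Ue.
have [m [m_itv m_mono m_gap]] := measure_distribution mU Ue.
have e0 : 0 <= e by have := m_itv 0; lra.
pose w1 x := sup [set r | r = 0 \/ exists2 s, Sigma s & s <= x /\ r = w s].
have w1_sup x : has_sup [set r | r = 0 \/ exists2 s, Sigma s & s <= x /\ r = w s].
  split; first by exists 0; left.
  by exists v => r [->//|[s Ss [_ ->]]]; have /andP[] := wv s Ss.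
have w1_ge s x : Sigma s -> s <= x -> w s <= w1 x.
  by move=> Ss sx; apply: sup_upper_bound => //; right; exists s.
have w1_ge0 x : 0 <= w1 x by apply: sup_upper_bound => //; left.
have w1_le x r : 0 <= r -> (forall s, Sigma s -> s <= x -> w s <= r) -> w1 x <= r.
  move=> r0 wr; apply: ge_sup; first by exists 0; left.
  by move=> _ [->//|[s Ss [sx ->]]]; exact: wr.
have m_free x y p q : exhaust n.+1 p -> x <= y -> J x -> J y ->
    (forall z, x < z < y -> forall s, Sigma s -> ~ (p <= s <= z) /\ ~ (z <= s <= p)) ->
    y - x <= m y - m x.
  move=> Ep xy /andP[ax _] /andP[_ yb] xyS; apply: m_gap => // z xzy.
  by apply: (exhaust_convex Ep) (xyS z xzy); apply/andP; split; lra.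
have dist_le x y : x <= y -> y - x <= m y - m x ->
    rnorm (F y - F x) <= L * (m y - m x).
  move=> xy mxy; rewrite (le_trans (FL _ _))// ler_wpM2l//.
  by rewrite ger0_norm ?subr_ge0.
have m_right x d : exhaust n.+1 x -> Sigma d -> x <= d ->
    (forall s, Sigma s -> x <= s -> d <= s) -> rnorm (F d - F x) <= L * (m d - m x).
  move=> Ex Sd xd dmin; apply: dist_le => //.
  apply: (m_free _ _ x) => //; [exact: exhaust_seg Ex|exact: calc_support_seg|].
  move=> z xzd s Ss; split; last by lra.
  by move=> /andP[xs sz]; have := dmin s Ss xs; lra.
have m_left y p : exhaust n.+1 y -> Sigma p -> p <= y ->
    (forall s, Sigma s -> s <= y -> s <= p) -> rnorm (F y - F p) <= L * (m y - m p).
  move=> Ey Sp py pmax; apply: dist_le => //.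
  apply: (m_free _ _ y) => //; [exact: calc_support_seg|exact: exhaust_seg Ey|].
  move=> z pzy s Ss; split; first by lra.
  by move=> /andP[zs sy]; have := pmax s Ss sy; lra.
have me x y : L * (m y - m x) <= L * e.
  by apply: ler_wpM2l => //; have := m_itv x; have := m_itv y; lra.
exists (c0 + L * e), (v + L * e); split.
- by rewrite addr_ge0// mulr_ge0.
- by rewrite addr_ge0// mulr_ge0.
- by lra.
- move=> x Ex; have [_ /(_ 0%N (ltn0Sn _))] := Ex.
  set q := rational 0 => not_gap.
  have [/nearest_left[p [Sp px pmax]]|no_left] := pselect (exists2 s, Sigma s & s <= x).
    rewrite -(subrK (F p) (F x)) (le_trans (rnormD _ _))// addrC lerD ?Fc0//.
    by rewrite (le_trans (m_left _ _ _ _ _ _)).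
  have [/nearest_right[d [Sd xd dmin]]|no_right] := pselect (exists2 s, Sigma s & x <= s).
    rewrite -(subrK (F d) (F x)) (le_trans (rnormD _ _))// addrC lerD ?Fc0//.
    by rewrite rdistC (le_trans (m_right _ _ _ _ _ _)).
  exfalso; apply: not_gap => s Ss; split => /andP[s1 s2].
    by apply: no_right; exists s.
  by apply: no_left; exists s.
- exists (fun x => w1 x + L * m x); split => [x Ex|x y Ex Ey xy].
    have /andP[m0 mxe] := m_itv x.
    rewrite addr_ge0 ?mulr_ge0//= lerD ?ler_wpM2l// w1_le// => s Ss _.
    by have /andP[] := wv s Ss.
  have -> : w1 y + L * m y - (w1 x + L * m x) = (w1 y - w1 x) + L * (m y - m x) by ring.
  have [[s0 Ss0 xs0y]|no_s] := pselect (exists2 s, Sigma s & x <= s <= y).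
    have [xs0 s0y] := andP xs0y.
    have [d [Sd xd dmin]] := nearest_right (ex_intro2 _ _ s0 Ss0 xs0).
    have [p [Sp py pmax]] := nearest_left (ex_intro2 _ _ s0 Ss0 s0y).
    have ds0 := dmin _ Ss0 xs0; have s0p := pmax _ Ss0 s0y.
    have dp : d <= p by exact: le_trans s0p.
    have H1 := m_right x d Ex Sd xd dmin; have H2 := m_left y p Ey Sp py pmax.
    have H3 := Fw d p Sd Sp dp; have H4 := w1_ge p y Sp py.
    have H5 : w1 x <= w d.
      apply: w1_le => [|s Ss sx]; first by have /andP[] := wv d Sd.
      have sd : s <= d by exact: le_trans xd.
      by have := Fw s d Ss Sd sd; have := rnorm_ge0 (F d - F s); lra.
    have H6 : L * (m d - m p) <= 0.
      by rewrite -(mulr0 L) ler_wpM2l// subr_le0 m_mono.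
    have H7 := rdist_triangle (F p) (F y) (F x).
    have H8 := rdist_triangle (F d) (F p) (F x).
    lra.
  have w1xy : 0 <= w1 y - w1 x.
    rewrite subr_ge0; apply: w1_le => // s Ss sx; apply: w1_ge => //.
    exact: le_trans xy.
  have : rnorm (F y - F x) <= L * (m y - m x).
    apply: dist_le => //; apply: (m_free _ _ x) => //; [exact: exhaust_seg Ex|exact: exhaust_seg Ey|].
    move=> z xzy s Ss; split; last by lra.
    by move=> /andP[xs sz]; apply: no_s; exists s => //; apply/andP; split => //; lra.
  lra.
Qed.

(** Each [exhaust n] controls [Psi], with a norm that exceeds the norm on the
support by arbitrarily little. *)
Theorem controls_support : controls a b Psi K Sigma.
Proof.
move=> F M [L L0 FL] FA FM u.
apply/ler_addgt0Pl => e e0; set y := rnorm u.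
have K0 := calc_ge0 calc; have y0 : 0 <= y := rnorm_ge0 u.
have Q0 : 0 <= K * (2 * L) * y by rewrite !mulr_ge0.
have d0 : 0 < e / (K * (2 * L) * y + 1) by rewrite divr_gt0// ltr_wpDl.
have [n mU Ue] := exhaust_small d0.
have := bv_le_exhaust L0 FL FM mU Ue.
set d := e / _ in d0 Ue * => FM'.
have FL' : is_lipschitz F by exists L.
rewrite (le_trans (@controls_exhaust n.+1 F _ FL' FA FM' u))// -/y.
have -> : K * (M + 2 * L * d) * y = d * (K * (2 * L) * y) + K * M * y by ring.
rewrite lerD2r (@le_trans _ _ (d * (K * (2 * L) * y + 1)))//.
  by rewrite ler_wpM2l ?(ltW d0)// lerDl.
by rewrite /d divfK// gt_eqF// ltr_wpDl.
Qed.

End Exhaustion.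

(** * Restricting a calculus *)

Section Extension.
Variables (R : realType) (X : completeNormedModType R[i]).

Lemma seq_limit (u : nat -> X) :
    (forall e : R, 0 < e -> exists N, forall n m, (N <= n)%N -> (N <= m)%N ->
      rnorm (u n - u m) <= e) ->
  exists l, forall e : R, 0 < e -> exists N, forall n, (N <= n)%N ->
    rnorm (u n - l) <= e.
Proof.
move=> u_cauchy.
have : cvg (u @ \oo).
  apply: cauchy_cvg; apply: cauchy_exP => e; rewrite ltcE/= => /andP[/eqP e_im e0].
  have eE : e = (complex.Re e)%:C by apply/eqP; rewrite eq_complex/= e_im !eqxx.
  have [N NP] := u_cauchy (complex.Re e / 2) ltac:(by rewrite divr_gt0).
  exists (u N), N => // n /= Nn; rewrite -ball_normE/= normE eE ltcR.
  by rewrite (le_lt_trans (NP _ _ (leqnn N) Nn))//; lra.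
move=> /cvgrPdist_le ul; exists (lim (u @ \oo)) => e e0.
have [|N _ NP] := ul e%:C; first by rewrite ltcR.
by exists N => n /NP/=; rewrite normE lecR rdistC.
Qed.

Lemma rnorm_le_small (v : X) (C : R) :
  0 <= C -> (forall e : R, 0 < e -> e <= 1 -> rnorm v <= e * C) -> v = 0.
Proof.
move=> C0 vC; apply: rnorm_small => e e0.
have C1 : 0 < C + 1 by rewrite ltr_wpDl.
pose d := Num.min 1 (e / (C + 1)).
have d0 : 0 < d by rewrite lt_min ltr01 divr_gt0.
rewrite (le_trans (vC d d0 _)) ?ge_min ?lexx//.
apply: (@le_trans _ _ (d * (C + 1))); first by rewrite ler_wpM2l ?(ltW d0)// lerDl.
by rewrite -ler_pdivlMr// ge_min lexx orbT.
Qed.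

Variables (a b : R) (T : {linear X -> X}).
Variables (Psi : (R -> R[i]) -> {linear X -> X}) (K : R).
Hypothesis calc : calculus (seg a b) T Psi K.
Hypothesis ab : a <= b.
Implicit Types (f g p q : R -> R[i]) (S : set R).

Local Notation J := (seg a b).
Let Jab : bounded_in J a b := @seg_bounded R a b.
Let K0 : 0 <= K := calc_ge0 calc.

(** The class for which the control by the support is known; it is dense in AC. *)
Definition lip_ac f := is_lipschitz f /\ ac J f.

Lemma lip_acD f g : lip_ac f -> lip_ac g -> lip_ac (f \+ g).
Proof.
move=> [[L L0 fL] fA] [[L' L'0 gL] gA]; split; last exact: acD.
exists (L + L') => [|x y]; first exact: addr_ge0.
by rewrite /= opprD addrACA (le_trans (rnormD _ _))// mulrDl lerD.
Qed.

Lemma lip_acZ c f : lip_ac f -> lip_ac (c \*o f).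
Proof.
move=> [[L L0 fL] fA]; split; last exact: acZ.
exists (rnorm c * L) => [|x y]; first by rewrite mulr_ge0// rnorm_ge0.
by rewrite /= -mulrBr rnormM -mulrA ler_wpM2l// rnorm_ge0.
Qed.

Lemma lip_acB f g : lip_ac f -> lip_ac g -> lip_ac (f \- g).
Proof.
move=> fA /(lip_acZ (-1)) gA; have -> : f \- g = f \+ (-1 \*o g).
  by apply/funext => y /=; rewrite mulN1r.
exact: lip_acD.
Qed.

Lemma lip_ac_cst c : lip_ac (cst c).
Proof.
split; last exact: ac_cst.
by exists 0 => // x y; rewrite /= subrr rnorm0 mul0r.
Qed.

Lemma lip_ac_id : lip_ac id_C.
Proof.
split; last exact: ac_id.
by exists 1 => // x y; rewrite /id_C -rmorphB rnormC mul1r.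
Qed.

(** A product of Lipschitz functions is Lipschitz if both are bounded, which is
achieved by making them constant off the segment. *)
Lemma lip_acM f g : lip_ac f -> lip_ac g ->
  exists2 h, lip_ac h & forall x, J x -> h x = f x * g x.
Proof.
move=> [[L L0 fL] fA] [[L' L'0 gL] gA].
pose h x := f (clamp a b x) * g (clamp a b x).
have clb p N : 0 <= N -> (forall x y, rnorm (p x - p y) <= N * `|x - y|) ->
    forall x, rnorm (p (clamp a b x)) <= rnorm (p a) + N * (b - a).
  move=> N0 pN x; rewrite -(subrK (p a) (p (clamp a b x))).
  rewrite (le_trans (rnormD _ _))// addrC lerD2l (le_trans (pN _ _))// ler_wpM2l//.
  by have := clamp_itv x ab; move=> cx; rewrite ger0_norm; lra.
exists h => [|x Jx]; last by rewrite /h clamp_id.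
split.
  exists (L * (rnorm (g a) + L' * (b - a)) + (rnorm (f a) + L * (b - a)) * L').
    by rewrite addr_ge0// mulr_ge0// addr_ge0 ?rnorm_ge0// mulr_ge0// subr_ge0.
  move=> x y; set s := clamp a b x; set t := clamp a b y.
  have -> : h x - h y = (f s - f t) * g s + f t * (g s - g t).
    by rewrite /h -/s -/t; ring.
  have st := clamp_lip x y ab; rewrite -/s -/t in st.
  have fst_le : rnorm (f s - f t) <= L * `|x - y|.
    by rewrite (le_trans (fL _ _))// ler_wpM2l.
  have gst_le : rnorm (g s - g t) <= L' * `|x - y|.
    by rewrite (le_trans (gL _ _))// ler_wpM2l.
  rewrite (le_trans (rnormD _ _))// !rnormM mulrDl lerD//.
    by rewrite mulrAC ler_pM ?rnorm_ge0//; exact: clb.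
  by rewrite -mulrA ler_pM ?rnorm_ge0//; exact: clb.
apply: eq_ac (acM fA gA) _ => x Jx.
by rewrite /h clamp_id.
Qed.

Lemma lip_ac_dense S f : S `<=` J -> ac S f -> forall e : R, 0 < e ->
  exists2 p, lip_ac p & bv_le S (f \- p) e.
Proof.
move=> SJ fA e e0.
have Sab : bounded_in S a b by move=> x /SJ.
have [||||||q [p pA qp] fq] := @ac_approx R S a b
  (fun q => exists2 p, lip_ac p & forall x, J x -> q x = p x) Sab _ _ _ _ _ _ f fA e e0.
- move=> q [p [_ pA] qp]; have [M pM] := ac_bv Jab pA; exists M.
  apply: eq_bv_le (bv_le_subset SJ pM) _ => x /SJ/qp//.
- by exists (cst 1) => //; exact: lip_ac_cst.
- by exists id_C => //; exact: lip_ac_id.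
- move=> q q' [p pA qp] [p' p'A qp']; exists (p \+ p'); first exact: lip_acD.
  by move=> x Jx /=; rewrite qp// qp'.
- move=> c q [p pA qp]; exists (c \*o p); first exact: lip_acZ.
  by move=> x Jx /=; rewrite qp.
- move=> q q' [p pA qp] [p' p'A qp']; have [h hA hE] := lip_acM pA p'A.
  by exists h => // x Jx /=; rewrite hE// qp// qp'.
by exists p => //; apply: eq_bv_le fq _ => x /SJ Jx /=; rewrite qp.
Qed.

Variable S : set R.
Hypothesis SJ : S `<=` J.
Hypothesis supportS : calc_support a b Psi `<=` S.

Lemma lip_ac_control p (M : R) : lip_ac p -> bv_le S p M ->
  forall x, rnorm (Psi p x) <= K * M * rnorm x.
Proof.
move=> [pL pA] pM; apply: (controls_support calc ab pL pA).
exact: bv_le_subset pM.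
Qed.

Definition extends f (A : X -> X) := forall p (M : R), lip_ac p ->
  bv_le S (f \- p) M -> forall x, rnorm (A x - Psi p x) <= K * M * rnorm x.

(** The value at [f] is the pointwise limit of [Psi p] for Lipschitz [p] that tend
to [f] in norm on [S]; it exists because [X] is complete. *)
Lemma extension_exists f : ac S f -> exists A : {linear X -> X}, extends f A.
Proof.
move=> fA.
have pt x : exists l, forall p (M : R), lip_ac p -> bv_le S (f \- p) M ->
    rnorm (l - Psi p x) <= K * M * rnorm x.
  have [d d0 d_small] : exists2 d : nat -> R, forall n, 0 < d n &
      forall e : R, 0 < e -> exists N, forall n, (N <= n)%N -> K * d n * rnorm x <= e.
    exists (fun n => n.+1%:R^-1) => [n|e e0]; first by rewrite invr_gt0.
    have Kre : 0 <= K * rnorm x / e by rewrite divr_ge0 ?(ltW e0)// mulr_ge0 ?rnorm_ge0.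
    exists (Num.bound (K * rnorm x / e)) => n Nn.
    rewrite mulrAC ler_pdivrMr// -ler_pdivrMl// mulrC.
    rewrite (le_trans (ltW (archi_boundP Kre)))// ler_nat.
    exact: leq_trans Nn (leqnSn n).
  have [p pP] : {p : nat -> R -> R[i] & forall n,
      lip_ac (p n) /\ bv_le S (f \- p n) (d n)}.
    apply: (@choice _ _ (fun n q => lip_ac q /\ bv_le S (f \- q) (d n))) => n.
    by have [q qA fq] := lip_ac_dense SJ fA (d0 n); exists q.
  have dist n q (M : R) : lip_ac q -> bv_le S (f \- q) M ->
      rnorm (Psi (p n) x - Psi q x) <= K * (M + d n) * rnorm x.
    move=> qA fq; have [pA fp] := pP n.
    have [_ qac] := qA; have [_ pac] := pA.
    rewrite -(calcB calc)//; apply: lip_ac_control; first exact: lip_acB.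
    by apply: eq_bv_le (bv_leB fq fp) _ => y _ /=; ring.
  have [|l lP] := @seq_limit (fun n => Psi (p n) x).
    move=> e e0; have [N NP] := d_small (e / 2) ltac:(by rewrite divr_gt0).
    exists N => n m Nn Nm; have [qA fq] := pP m.
    have := dist n (p m) _ qA fq; have := NP n Nn; have := NP m Nm.
    by rewrite mulrDr mulrDl; lra.
  exists l => q M qA fq; apply/ler_addgt0Pl => e e0.
  have [N NP] := d_small (e / 2) ltac:(by rewrite divr_gt0).
  have [N' N'P] := lP (e / 2) ltac:(by rewrite divr_gt0).
  pose n := maxn N N'.
  have := N'P n (leq_maxr _ _); have := NP n (leq_maxl _ _).
  have := dist n q M qA fq; have := rdist_triangle (Psi (p n) x) l (Psi q x).
  by rewrite (rdistC l (Psi (p n) x)) mulrDr mulrDl; lra.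
have [A AP] := choice pt.
have A_lin : linear A.
  move=> c x y; apply/eqP; rewrite -subr_eq0; apply/eqP.
  apply: (@rnorm_le_small _ (K * rnorm (c *: x + y) + rnorm c * (K * rnorm x) + K * rnorm y)).
    by rewrite !addr_ge0// ?mulr_ge0 ?rnorm_ge0.
  move=> e e0 _; have [p pA fp] := lip_ac_dense SJ fA e0.
  have -> : A (c *: x + y) - (c *: A x + A y) =
      (A (c *: x + y) - Psi p (c *: x + y)) - (c *: (A x - Psi p x) + (A y - Psi p y)).
    by rewrite linearP scalerBr [c *: _ - _ + _]addrACA -opprD opprB addrA subrK.
  rewrite (le_trans (rnormB _ _))//.
  have := rnormD (c *: (A x - Psi p x)) (A y - Psi p y); rewrite rnormZ.
  have H1 := AP (c *: x + y) p e pA fp; have H3 := AP y p e pA fp.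
  have H2 := ler_wpM2l (rnorm_ge0 c) (AP x p e pA fp).
  by rewrite !mulrDr; lra.
pose A' : {linear X -> X} :=
  HB.pack A (GRing.isLinear.Build R[i] X X *:%R A A_lin).
by exists A' => p M pA fp x; exact: AP.
Qed.

(** Approximating by Lipschitz functions transports the calculus from [J] to
[S]: the values on Lipschitz functions are controlled by their norm on [S]. *)
Theorem calculus_restrict : exists Phi, calculus S T Phi K.
Proof.
have Sab : bounded_in S a b by move=> x /SJ.
have [Phi PhiP] : {Phi : (R -> R[i]) -> {linear X -> X} &
    forall f, ac S f -> extends f (Phi f)}.
  apply: (@choice _ _ (fun f (A : {linear X -> X}) => ac S f -> extends f A)) => f.
  have [/extension_exists[A AP]|nA] := pselect (ac S f); first by exists A.
  by exists (Psi f) => /nA.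
exists Phi.
have Phi_bound f M x : ac S f -> bv_le S f M -> rnorm (Phi f x) <= K * M * rnorm x.
  move=> fA fM; have := PhiP f fA (cst 0) M (lip_ac_cst 0) _ x.
  rewrite (calc_eq0 calc x (ac_cst _ 0))// subr0; apply.
  by apply: eq_bv_le fM _ => y _ /=; rewrite subr0.
have Phi_eq p x : lip_ac p -> Phi p x = Psi p x.
  move=> pA; have [_ pac] := pA.
  apply/eqP; rewrite -subr_eq0; apply/eqP/rnorm_eq0.
  have := PhiP p (ac_subset Jab SJ pac) p 0 pA; rewrite mulr0.
  move=> /(_ _ x); rewrite mul0r; apply.
  rewrite -(rnorm0 R[i]); apply: eq_bv_le (bv_le_cst S 0) _ => y _ /=.
  by rewrite subrr.
split => //.
- move=> f g x fA gA; have fgA := acD fA gA.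
  apply/eqP; rewrite -subr_eq0; apply/eqP; set r := rnorm x.
  apply: (@rnorm_le_small _ (K * 4 * r)); first by rewrite !mulr_ge0// rnorm_ge0.
  move=> e e0 _.
  have [p pA fp] := lip_ac_dense SJ fA e0; have [q qA gq] := lip_ac_dense SJ gA e0.
  have fgpq : bv_le S (f \+ g \- (p \+ q)) (e + e).
    by apply: eq_bv_le (bv_leD fp gq) _ => y _ /=; ring.
  have H1 := PhiP _ fgA _ _ (lip_acD pA qA) fgpq x.
  have H2 := PhiP _ fA _ _ pA fp x; have H3 := PhiP _ gA _ _ qA gq x.
  have -> : Phi (f \+ g) x - (Phi f x + Phi g x) =
      (Phi (f \+ g) x - Psi (p \+ q) x) - ((Phi f x - Psi p x) + (Phi g x - Psi q x)).
    have [_ pac] := pA; have [_ qac] := qA.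
    by rewrite (calcD calc)// [Phi f x - _ + _]addrACA -opprD opprB addrA subrK.
  rewrite (le_trans (rnormB _ _))//.
  have := rnormD (Phi f x - Psi p x) (Phi g x - Psi q x).
  by move: H1; rewrite mulrDr mulrDl -/r; lra.
- move=> c f x fA; have cfA := acZ c fA.
  apply/eqP; rewrite -subr_eq0; apply/eqP; set r := rnorm x.
  apply: (@rnorm_le_small _ (2 * (rnorm c * (K * r)))).
    by rewrite !mulr_ge0// rnorm_ge0.
  move=> e e0 _; have [p pA fp] := lip_ac_dense SJ fA e0.
  have cfp : bv_le S (c \*o f \- c \*o p) (rnorm c * e).
    by apply: eq_bv_le (bv_leZ c fp) _ => y _ /=; ring.
  have H1 := PhiP _ cfA _ _ (lip_acZ c pA) cfp x.
  have H2 := ler_wpM2l (rnorm_ge0 c) (PhiP _ fA _ _ pA fp x).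
  have -> : Phi (c \*o f) x - c *: Phi f x =
      (Phi (c \*o f) x - Psi (c \*o p) x) - c *: (Phi f x - Psi p x).
    have [_ pac] := pA.
    by rewrite (calcZ calc)// scalerBr opprB addrA subrK.
  rewrite (le_trans (rnormB _ _))// rnormZ.
  by move: H1 H2; rewrite -/r; lra.
- move=> f g x fA gA; have fgA := acM fA gA.
  have [M fM] := ac_bv Sab fA; have [N gN] := ac_bv Sab gA.
  have M0 := bv_le_ge0 fM; have N0 := bv_le_ge0 gN.
  apply/eqP; rewrite -subr_eq0; apply/eqP; set r := rnorm x.
  have r0 : 0 <= r := rnorm_ge0 x.
  apply: (@rnorm_le_small _
    (K * (N + M + 1) * r + (K * (K * (N + 1) * r) + K * M * (K * r)))).
    by rewrite !addr_ge0// ?mulr_ge0// !addr_ge0.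
  move=> e e0 e1.
  have [p pA fp] := lip_ac_dense SJ fA e0; have [q qA gq] := lip_ac_dense SJ gA e0.
  have [_ pac] := pA; have [_ qac] := qA.
  have [h hA hE] := lip_acM pA qA; have [_ hac] := hA.
  have fgh : bv_le S (f \* g \- h) (e * (N + M + 1)).
    apply: (@bv_le_trans _ _ _ (e * N + M * e + e * e)).
      by have := ler_wpM2l (ltW e0) e1; lra.
    apply: eq_bv_le (bv_leB (bv_leD (bv_leM fp gN) (bv_leM fM gq)) (bv_leM fp gq)) _.
    by move=> y /SJ Jy /=; rewrite hE//; ring.
  have hpq : Psi h x = Psi p (Psi q x).
    rewrite -(calcM calc)//; apply: (calc_eq calc) => //; exact: acM.
  have H1 := PhiP _ fgA _ _ hA fgh x; rewrite hpq -/r in H1.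
  have H2 := PhiP _ fA _ _ pA fp (Psi q x); have H3 := PhiP _ gA _ _ qA gq x.
  rewrite -/r in H3.
  have H4 := Phi_bound f M (Phi g x - Psi q x) fA fM.
  have H5 := Phi_bound g N x gA gN; rewrite -/r in H5.
  have H6 := rdist_triangle (Phi g x) (Psi q x) 0; rewrite !subr0 rdistC in H6.
  have -> : Phi (f \* g) x - Phi f (Phi g x) = (Phi (f \* g) x - Psi p (Psi q x)) -
      ((Phi f (Psi q x) - Psi p (Psi q x)) + Phi f (Phi g x - Psi q x)).
    rewrite linearB/= [Phi f (Psi q x) - _ + _]addrC addrA subrK.
    by rewrite opprB addrA subrK.
  rewrite (le_trans (rnormB _ _))//.
  have := rnormD (Phi f (Psi q x) - Psi p (Psi q x)) (Phi f (Phi g x - Psi q x)).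
  have H7 : rnorm (Psi q x) <= K * (N + 1) * r.
    have : K * e * r <= K * 1 * r by rewrite ler_wpM2r// ler_wpM2l.
    by lra.
  have H8 : K * e * rnorm (Psi q x) <= K * e * (K * (N + 1) * r).
    by apply: ler_wpM2l => //; rewrite mulr_ge0// ltW.
  have H9 : K * M * rnorm (Phi g x - Psi q x) <= K * M * (K * e * r).
    by apply: ler_wpM2l => //; rewrite mulr_ge0.
  by lra.
- by move=> x; rewrite Phi_eq ?(calc1 calc)//; exact: lip_ac_cst.
- by move=> x; rewrite Phi_eq ?(calc_id calc)//; exact: lip_ac_id.
- by move=> f M fA fM x; exact: Phi_bound.
Qed.

End Extension.

(** * Well-bounded operators *)

Section RealSpectrum.
Variables (R : realType) (X : completeNormedModType R[i]).
Implicit Types (T : {linear X -> X}) (sigma : set R[i]^o).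

Lemma well_boundedP T : well_bounded T <->
  exists a b : R, a <= b /\ AC_operator (reals (seg a b)) T.
Proof.
have segE (a b : R) : [set x%:C | x in `[a, b]] = reals (seg a b).
  by congr image; apply/seteqP; split => x; rewrite /= in_itv.
by split => -[a [b [ab]]]; exists a, b; split => //; rewrite -?segE// segE.
Qed.

Lemma real_setE sigma : sigma `<=` [set z | z \is Num.real] ->
  sigma = reals [set x : R | sigma x%:C].
Proof.
move=> sigma_real; apply/seteqP; split => [z sz|_ [x sx <-]//].
have /complex_realP[x zx] := sigma_real z sz.
by exists x; rewrite ?zx//= -zx.
Qed.

Lemma bounded_well_bounded sigma T (B : R) :
    sigma `<=` [set z | z \is Num.real] -> (forall z, sigma z -> rnorm z <= B) ->
  AC_operator sigma T -> well_bounded T.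
Proof.
move=> sigma_real sigma_B; rewrite (real_setE sigma_real).
set S := [set x | _] => TS; apply/well_boundedP.
have SB : bounded_in S (- `|B|) `|B|.
  move=> x /sigma_B; rewrite rnormC => xB; rewrite -ler_norml.
  exact: le_trans (ler_norm B).
exists (- `|B|), `|B|; split; first by have := normr_ge0 B; lra.
have /(AC_operator_calculus T SB)[Psi [K calc]] := TS.
apply/(AC_operator_calculus T (@seg_bounded _ _ _)); exists Psi, K.
by apply: calculus_superset calc; [exact: seg_bounded|exact: SB].
Qed.

(** If the spectrum [sigma] is unbounded then no subalgebra of bounded
functions contains the identity, so AC is the algebra of all functions. Then
the calculus evaluates the indicator [d] of any point [z] to a projection on
which [T = z]; once [|z|] exceeds the norm of [T] it vanishes, and the calculus
evaluates [1 / (z - w)] (with value [0] at [z]) to a resolvent at [z]. *)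
Lemma spectrum_bounded T : continuous T -> AC_operator (spectrum T) T ->
  exists B : R, forall z, spectrum T z -> rnorm z <= B.
Proof.
move=> T_cont [psi [[[psi_cont psiD psiZ psiM psi1] _] psi_id]].
apply: contrapT => unbounded.
have AC_all (f : spectrum T -> R[i]) : AC_space f.
  move=> A [[A_BV _ _ _ _] genA]; exfalso; apply: unbounded.
  have : BV_space (@lambda R (spectrum T)) by apply: A_BV; apply: genA; constructor 2.
  have sup0 : (0 <= supnorm (@lambda R (spectrum T)))%E by exact: nnsup_ge0.
  have var0 : (0 <= var (@lambda R (spectrum T)))%E by exact: nnsup_ge0.
  rewrite /BV_space/= /BVnorm => fin.
  have sup_fin : supnorm (@lambda R (spectrum T)) \is a fin_num.
    by rewrite ge0_fin_numE// (le_lt_trans _ fin)// leeDl.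
  exists (fine (supnorm (@lambda R (spectrum T)))) => z zT.
  rewrite -lee_fin fineK//; apply: nnsup_ub.
  by exists (SigSub (mem_set zT)).
have [M M0 TM] := continuous_rbound T_cont.
have [z zT zM] : exists2 z, spectrum T z & M < rnorm z.
  apply: contrapT => no_z; apply: unbounded; exists M => z zT.
  by rewrite leNgt; apply/negP => zM; apply: no_z; exists z.
apply: zT; pose d (w : spectrum T) : R[i] := if \val w == z then 1 else 0.
pose r (w : spectrum T) : R[i] := (z - \val w)^-1.
pose k : spectrum T -> R[i] := (z \*o cst 1) \+ (-1 \*o @lambda R (spectrum T)).
have psi_d x : psi d x = 0.
  apply: rnorm_eq0; have Td : T (psi d x) = z *: psi d x.
    rewrite -psi_id -[LHS]psiM// -[RHS]psiZ//; congr (psi _ x).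
    apply/funext => w; rewrite /= /lambda /d.
    by case: eqP => [->//|_]; rewrite !mulr0.
  have := TM (psi d x); rewrite Td rnormZ => zd.
  rewrite leNgt; apply/negP => d0.
  by move: zd; rewrite leNgt ltr_pM2r// zM.
have psi_k x : psi k x = z *: x - T x.
  by rewrite psiD// /= !psiZ// /= psi1 psi_id scaleN1r.
have kr x : psi (k \* r) x = x.
  have -> : k \* r = cst 1 \+ (-1 \*o d).
    apply/funext => w; rewrite /k /= /lambda /r /d mulr1 !mulN1r.
    case: eqP => [->|/eqP wz]; first by rewrite subrr mul0r subrr.
    by rewrite oppr0 addr0 mulfV// subr_eq0 eq_sym.
  by rewrite psiD// /= psi1 psiZ// /= psi_d scaler0 addr0.
exists (psi r); split => [|x|x].
- exact: psi_cont.
- rewrite -psi_k -[LHS](psiM r k)// -[RHS]kr; congr (psi _ x).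
  by apply/funext => w /=; rewrite mulrC.
- by rewrite -psi_k -[LHS](psiM k r)// kr.
Qed.

Lemma compact_reals (a b : R) : compact (reals (seg a b)).
Proof.
have segE : seg a b = `[a, b]%classic.
  by apply/seteqP; split => x; rewrite /= in_itv.
rewrite /reals segE; apply: continuous_compact; last exact: segment_compact.
apply: continuous_subspaceT => x; apply/cvgrPdist_lt => e.
rewrite ltcE/= => /andP[/eqP e_im e0].
have eE : e = (complex.Re e)%:C by apply/eqP; rewrite eq_complex/= e_im !eqxx.
exists (complex.Re e) => //= y xy.
by rewrite -rmorphB/= normE rnormC eE ltcR.
Qed.

Lemma compact_rnorm_bounded sigma : compact sigma ->
  exists B : R, forall z, sigma z -> rnorm z <= B.
Proof.
move=> sigma_compact.
have rnorm_cont : {within sigma, continuous (fun z : R[i]^o => rnorm z)}.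
  apply: continuous_subspaceT => z.
  have Fz : Filter (nbhs (z : R[i]^o)) by exact: nbhs_filter.
  apply/cvgrPdist_lt => e e0; exists e%:C; first by rewrite /= ltcR.
  move=> y /= zy; rewrite -ltcR; apply: le_lt_trans zy.
  rewrite normE lecR ler_norml; have := rnormD (z - y) y; have := rnormD (y - z) z.
  by rewrite !subrK (rdistC y z); lra.
have [r [_ rP]] := compact_bounded (continuous_compact rnorm_cont sigma_compact).
exists (r + 1) => z sz; rewrite (le_trans (ler_norm _))//.
by apply: (rP (r + 1)); [rewrite ltrDl|exists z].
Qed.

End RealSpectrum.

Theorem proposition4p4 (R : realType) (X : completeNormedModType R[i])
    (T : {linear X -> X}) (cT : continuous T) :
  (well_bounded T <->
    exists sigma : set R[i]^o,
      [/\ sigma !=set0, compact sigma, sigma `<=` [set z | z \is Num.real] &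
          AC_operator sigma T]) /\
  ((exists sigma : set R[i]^o,
      [/\ sigma !=set0, compact sigma, sigma `<=` [set z | z \is Num.real] &
          AC_operator sigma T]) <->
    spectrum T `<=` [set z | z \is Num.real] /\ AC_operator (spectrum T) T).
Proof.
have wb_sigma : well_bounded T -> exists sigma : set R[i]^o,
    [/\ sigma !=set0, compact sigma, sigma `<=` [set z | z \is Num.real] &
        AC_operator sigma T].
  move=> /well_boundedP[a [b [ab Tab]]]; exists (reals (seg a b)); split => //.
  - by exists a%:C, a => //; rewrite /seg/= lexx.
  - exact: compact_reals.
  - by move=> _ [x _ <-]; apply/complex_realP; exists x.
have sigma_wb : (exists sigma : set R[i]^o,
    [/\ sigma !=set0, compact sigma, sigma `<=` [set z | z \is Num.real] &
        AC_operator sigma T]) -> well_bounded T.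
  move=> [sigma [_ /compact_rnorm_bounded[B sigma_B] sigma_real Tsigma]].
  exact: bounded_well_bounded sigma_B Tsigma.
split; split => //.
  move=> /sigma_wb/well_boundedP[a [b [ab Tab]]].
  have /(AC_operator_calculus T (@seg_bounded _ a b))[Psi [K calc]] := Tab.
  have TJ := spectrum_subset calc.
  have T_real : spectrum T `<=` [set z | z \is Num.real].
    by move=> z /TJ[x _ <-]; apply/complex_realP; exists x.
  split => //; rewrite (real_setE T_real); set S := [set x | _].
  have SJ : S `<=` seg a b by move=> x /TJ[y Jy /complexI <-].
  have SB : bounded_in S a b by move=> x /SJ.
  apply/(AC_operator_calculus T SB).
  have [|Phi calcS] := calculus_restrict calc ab SJ; last by exists Phi, K.
  by move=> s Ss; apply: contrapT => sT; apply: Ss; exact: null_resolvent calc _ sT.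
move=> [T_real TT]; apply: wb_sigma.
have [B TB] := spectrum_bounded cT TT.
exact: bounded_well_bounded T_real TB TT.
Qed.
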